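(* Let $\ell \ge 1$ be an integer (with $C_1^{(1)}=A_1^{(1)}$). With the subalgebra $L_{A_1^{(1)}}(-\Lambda_0)^{\otimes \ell} \subset L_{C_\ell^{(1)}}(-\tfrac12\Lambda_0)\otimes L_{C_\ell^{(1)}}(-\tfrac12\Lambda_0)$ and the $\ell$-dimensional space $\mathfrak h$ described in the context, there is an isomorphism of vertex algebras $$\mathrm{Com}\big(L_{A_1^{(1)}}(-\Lambda_0)^{\otimes \ell},\ L_{C_\ell^{(1)}}(-\tfrac12\Lambda_0)\otimes L_{C_\ell^{(1)}}(-\tfrac12\Lambda_0)\big)\ \cong\ M_{\mathfrak h}(1)^+ .$$
   Context: All vertex algebras are over $\mathbb C$. For a vertex subalgebra $U\subset V$, $\mathrm{Com}(U,V)=\{v\in V \mid u_n v=0 \text{ for all } u\in U,\ n\ge 0\}$. For an affine Lie algebra of type $X_n^{(1)}$ with fundamental weights $\Lambda_i$, $L_{X_n^{(1)}}(\Lambda)$ is the irreducible highest weight module of highest weight $\Lambda$; $L_{X_n^{(1)}}(k\Lambda_0)$, $k\neq -h^\vee$, is the simple affine vertex operator algebra of level $k$. Heisenberg algebra: for a finite-dimensional space $\mathfrak h$ with nondegenerate symmetric bilinear form, $M_{\mathfrak h}(1)=S(\mathfrak h\otimes t^{-1}\mathbb C[t^{-1}])$ is the associated Heisenberg (free boson) vertex operator algebra of level 1, and $M_{\mathfrak h}(1)^+$ is the subalgebra of fixed points of the order-two automorphism lifted from $h\mapsto -h$, $h\in\mathfrak h$. Weyl vertex algebra $M_m$: the algebra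 with generators $a_i^\pm(r)$, $r\in\tfrac12+\mathbb Z$, $1\le i\le m$, and only non-trivial relations $[a_i^+(r),a_j^-(s)]=\delta_{r+s,0}\delta_{i,j}$ has an irreducible module $M_m$ generated by $\mathbf 1$ with $a_i^\pm(r)\mathbf 1=0$ for $r>0$; the fields $a_i^\pm(z)=\sum_{n\in\mathbb Z}a_i^\pm(n+\tfrac12)z^{-n-1}$ generate on $M_m$ a unique simple vertex algebra structure. Let $M_m^0$ be the fixed points of the automorphism $a_i^\pm(r)\mapsto -a_i^\pm(r)$. It is known that $M_\ell^0\cong L_{C_\ell^{(1)}}(-\tfrac12\Lambda_0)$. In $M_{2\ell}$ put, for $i=1,\dots,\ell$, $b_i^+=\tfrac1{\sqrt2}(a_i^+(-\tfrac12)+a_{2\ell+1-i}^-(-\tfrac12))\mathbf 1$, $b_{2\ell+1-i}^+=\tfrac{\sqrt{-1}}{\sqrt2}(a_i^+(-\tfrac12)-a_{2\ell+1-i}^-(-\tfrac12))\mathbf 1$, $b_i^-=\tfrac1{\sqrt2}(a_i^-(-\tfrac12)-a_{2\ell+1-i}^+(-\tfrac12))\mathbf 1$, $b_{2\ell+1-i}^-=\tfrac{-\sqrt{-1}}{\sqrt2}(a_i^-(-\tfrac12)+a_{2\ell+1-i}^+(-\tfrac12))\mathbf 1$. The subalgebra generated by the $b_i^\pm$ ($1\le i\le\ell$) and the one generated by the $b_{2\ell+1-i}^\pm$ ($1\le i\le \ell$) are each isomorphic to $M_\ell$, and $M_{2\ell}$ is their tensor product. Then $L_{C_\ell^{(1)}}(-\tfrac12\Lambda_0)\otimes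 L_{C_\ell^{(1)}}(-\tfrac12\Lambda_0)$ is identified with $M_\ell^0\otimes M_\ell^0\subset M_\ell\otimes M_\ell= M_{2\ell}$ for this decomposition. The subalgebra $L_{A_1^{(1)}}(-\Lambda_0)^{\otimes\ell}$ is the subalgebra of $M_\ell^0\otimes M_\ell^0$ generated by $e^{(i)}=a_i^+(-\tfrac12)a_{2\ell+1-i}^-(-\tfrac12)\mathbf 1$, $f^{(i)}=a_i^-(-\tfrac12)a_{2\ell+1-i}^+(-\tfrac12)\mathbf 1$, $h^{(i)}=(-a_i^+(-\tfrac12)a_i^-(-\tfrac12)+a_{2\ell+1-i}^+(-\tfrac12)a_{2\ell+1-i}^-(-\tfrac12))\mathbf 1$, $i=1,\dots,\ell$. $\mathfrak h=\bigoplus_{i=1}^\ell\mathbb C H^{(i)}$, where $H^{(i)}=(a_i^+(-\tfrac12)a_i^-(-\tfrac12)+a_{2\ell+1-i}^+(-\tfrac12)a_{2\ell+1-i}^-(-\tfrac12))\mathbf 1\in M_{2\ell}$, with form $\langle H^{(i)},H^{(j)}\rangle=-2\delta_{ij}$. *)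

(* Defs.v *)
From HB Require Import structures.
From mathcomp Require Import all_boot all_order all_algebra.
From mathcomp Require Import reals complex.

Set Implicit Arguments.
Unset Strict Implicit.
Unset Printing Implicit Defensive.

Import Order.TTheory GRing.Theory Num.Theory.
Local Open Scope ring_scope.

(* p (p - 1) ... (p - i + 1) / i! for p in Z; 'C(- n.+1, i) = (-1)^i 'C(n + i, i). *)
Definition binz (p : int) (i : nat) : int :=
  match p with
  | Posz n => 'C(n, i)%:Z
  | Negz n => (-1) ^+ i * 'C(n + i, i)%:Z
  end.

(* [vprod n u v] is u_n v, where Y(u, z) v = \sum_n u_n v z^(-n-1).
   In [borcherds] both sums over i >= 0 have finitely many nonzero terms by
   [vprod_trunc]; hence the equality of all large enough partial sums. *)
Record vertexAlgebra (K : fieldType) := VertexAlgebra {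
  vspace_of :> lmodType K;
  vacuum : vspace_of;
  vprod : int -> vspace_of -> vspace_of -> vspace_of;
  vprod_linearr : forall n u, linear (vprod n u);
  vprod_linearl : forall n v, linear (fun u => vprod n u v);
  vprod_trunc : forall u v, exists N : int, forall n, N <= n -> vprod n u v = 0;
  vprod_vacuuml : forall n v, vprod n vacuum v = if n == -1 then v else 0;
  vprod_creation : forall n u, 0 <= n -> vprod n u vacuum = 0;
  vprod_creationN1 : forall u, vprod (-1) u vacuum = u;
  borcherds : forall (p q r : int) u v w, exists N0 : nat, forall N : nat,
    (N0 <= N)%N ->
    \sum_(i < N) (binz p i)%:~R *:
        vprod (p + q - i%:Z) (vprod (r + i%:Z) u v) w =
    \sum_(i < N) ((-1) ^+ i * (binz r i)%:~R) *:
        (vprod (p + r - i%:Z) u (vprod (q + i%:Z) v w) -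
         (-1) ^ r *: vprod (q + r - i%:Z) v (vprod (p + i%:Z) u w))
}.
Arguments vacuum {K _}.
Arguments vprod {K _}.

Section Subalgebras.
Variable K : fieldType.
Implicit Types V W : vertexAlgebra K.

Definition subspace V (S : V -> Prop) : Prop :=
  S 0 /\ forall (c : K) u v, S u -> S v -> S (c *: u + v).

Definition lin_span V (G : V -> Prop) (v : V) : Prop :=
  forall S : V -> Prop, subspace S -> (forall g, G g -> S g) -> S v.

Definition vertex_subalgebra V (S : V -> Prop) : Prop :=
  [/\ subspace S, S vacuum & forall n u v, S u -> S v -> S (vprod n u v)].

Definition generated_subalgebra V (G : V -> Prop) (v : V) : Prop :=
  forall S : V -> Prop, vertex_subalgebra S -> (forall g, G g -> S g) -> S v.

Definition commutant V (U A : V -> Prop) (v : V) : Prop :=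
  A v /\ forall u (n : int), U u -> 0 <= n -> vprod n u v = 0.

(* If V is the tensor product of two subalgebras, u (x) w being u_{-1} w, then
   for subspaces U and A of the two factors this is U (x) A inside V. *)
Definition tensor_subspace V (U A : V -> Prop) : V -> Prop :=
  lin_span (fun x => exists u w, [/\ U u, A w & x = vprod (-1) u w]).

(* Only the restriction of f to A matters. *)
Definition vertex_isomorphism V W (A : V -> Prop) (B : W -> Prop)
    (f : V -> W) : Prop :=
  [/\ forall (c : K) u v, A u -> A v -> f (c *: u + v) = c *: f u + f v,
      f vacuum = vacuum
    & forall n u v, A u -> A v -> f (vprod n u v) = vprod n (f u) (f v)] /\
  [/\ forall u, A u -> B (f u),
      forall u v, A u -> A v -> f u = f v -> u = v
    & forall w, B w -> exists2 u, A u & f u = w].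

Definition isomorphic V W (A : V -> Prop) (B : W -> Prop) : Prop :=
  [/\ vertex_subalgebra A, vertex_subalgebra B
    & exists f : V -> W, vertex_isomorphism A B f].

(* The fixed points in A of the automorphism of A acting by -1 on a set G of
   generators of A (there is at most one such automorphism). *)
Definition sign_fixed V (A G : V -> Prop) (v : V) : Prop :=
  A v /\ exists s : V -> V,
    [/\ vertex_isomorphism A A s, forall g, G g -> s g = - g & s v = v].

End Subalgebras.

(* [ap i n] and [am i n] are the operators a_i^+(n + 1/2) and a_i^-(n + 1/2), so
   that a_i^±(-1/2) has index -1.  The clauses say that M is the irreducible
   vacuum module of the Weyl algebra and that its vertex algebra structure
   satisfies Y(a_i^±(-1/2) 1, z) = \sum_n a_i^±(n + 1/2) z^(-n-1). *)
Record weyl_vertex_algebra (K : fieldType) (m : nat) (M : vertexAlgebra K)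
    (ap am : 'I_m -> int -> {linear M -> M}) : Prop := {
  weyl_pp : forall i j n k v, ap i n (ap j k v) = ap j k (ap i n v);
  weyl_mm : forall i j n k v, am i n (am j k v) = am j k (am i n v);
  weyl_pm : forall i j n k v, ap i n (am j k v) - am j k (ap i n v) =
    if (i == j) && (n + k + 1 == 0) then v else 0;
  weyl_vacuum : forall i (n : int), 0 <= n ->
    ap i n vacuum = 0 /\ am i n vacuum = 0;
  weyl_vacuum_neq0 : (vacuum : M) != 0;
  weyl_generated : forall S : M -> Prop, subspace S ->
    (forall i n v, S v -> S (ap i n v) /\ S (am i n v)) ->
    S vacuum -> forall v, S v;
  weyl_irreducible : forall S : M -> Prop, subspace S ->
    (forall i n v, S v -> S (ap i n v) /\ S (am i n v)) ->
    (exists2 u, S u & u != 0) -> forall v, S v;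
  weyl_field_p : forall i n v, vprod n (ap i (-1) vacuum) v = ap i n v;
  weyl_field_m : forall i n v, vprod n (am i (-1) vacuum) v = am i n v
}.

Section Heisenberg.
Variables (K : fieldType) (h : vectType K) (form : h -> h -> K).
Variables (W : vertexAlgebra K) (hm : h -> int -> {linear W -> W}).

(* The product of the commuting operators x_j(-k-1), (j, k) in s, on 1. *)
Definition heis_monomial d (X : d.-tuple h) (s : seq ('I_d * nat)) : W :=
  foldr (fun jk w => hm (tnth X jk.1) (- (jk.2.+1)%:Z) w) vacuum s.

(* [hm u n] is u(n) = u (x) t^n.  [heis_span] and [heis_free] say that the
   monomials in the x_j (x) t^(-k-1), taken up to reordering, form a basis of W,
   i.e. that the action on 1 identifies S(h (x) t^-1 K[t^-1]) with W. *)
Record heisenberg_vertex_algebra : Prop := {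
  heis_linear : forall n w, linear (fun u => hm u n w);
  heis_comm : forall u v m n w, hm u m (hm v n w) - hm v n (hm u m w) =
    if m + n == 0 then (m%:~R * form u v) *: w else 0;
  heis_vacuum : forall u (n : int), 0 <= n -> hm u n vacuum = 0;
  heis_span : forall X : (\dim {:h}).-tuple h, basis_of {:h} X ->
    forall w, lin_span (fun x => exists s, x = heis_monomial X s) w;
  heis_free : forall X : (\dim {:h}).-tuple h, basis_of {:h} X ->
    forall (ss : seq (seq ('I_(\dim {:h}) * nat)))
           (c : seq ('I_(\dim {:h}) * nat) -> K),
    pairwise (fun s t => ~~ perm_eq s t) ss ->
    \sum_(s <- ss) c s *: heis_monomial X s = 0 ->
    forall s, s \in ss -> c s = 0;
  heis_field : forall u n w, vprod n (hm u (-1) vacuum) w = hm u n w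
}.

Definition heisenberg_plus : W -> Prop :=
  sign_fixed (fun=> True) (fun x => exists u, x = hm u (-1) vacuum).

End Heisenberg.

(* The space with basis H^(i) = 'e_i and <H^(i), H^(j)> = -2 delta_ij. *)
Definition hform (K : fieldType) (l : nat) (u v : 'rV[K]_l) : K :=
  - 2 * \sum_(i < l) u 0 i * v 0 i.

Section InsideWeyl.
Variables (K : numClosedFieldType) (l : nat) (M : vertexAlgebra K).
Variables (ap am : 'I_(l + l) -> int -> {linear M -> M}).

(* For i : 'I_l, the indices i and 2l + 1 - i (when counted from 1). *)
Definition idx (i : 'I_l) : 'I_(l + l) := lshift l i.
Definition idx' (i : 'I_l) : 'I_(l + l) := rev_ord (lshift l i).

Let vp i : M := ap i (-1) vacuum.
Let vm i : M := am i (-1) vacuum.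

Definition bp i : M := (sqrtC 2)^-1 *: (vp (idx i) + vm (idx' i)).
Definition bp' i : M := ('i / sqrtC 2) *: (vp (idx i) - vm (idx' i)).
Definition bm i : M := (sqrtC 2)^-1 *: (vm (idx i) - vp (idx' i)).
Definition bm' i : M := (- 'i / sqrtC 2) *: (vm (idx i) + vp (idx' i)).

Definition bgen (x : M) : Prop := exists i, x = bp i \/ x = bm i.
Definition bgen' (x : M) : Prop := exists i, x = bp' i \/ x = bm' i.

(* The two tensor factors M_l^0 of M_l^0 (x) M_l^0, each of them realizing
   L(-1/2 Lambda_0) for C_l^(1). *)
Definition weyl_even : M -> Prop :=
  sign_fixed (generated_subalgebra bgen) bgen.
Definition weyl_even' : M -> Prop :=
  sign_fixed (generated_subalgebra bgen') bgen'.

Definition affine_C_square : M -> Prop := tensor_subspace weyl_even weyl_even'.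

Definition e_vec i : M := ap (idx i) (-1) (am (idx' i) (-1) vacuum).
Definition f_vec i : M := am (idx i) (-1) (ap (idx' i) (-1) vacuum).
Definition h_vec i : M :=
  - ap (idx i) (-1) (am (idx i) (-1) vacuum)
  + ap (idx' i) (-1) (am (idx' i) (-1) vacuum).

(* L(-Lambda_0)^{(x) l} for A_1^(1). *)
Definition affine_A1_power : M -> Prop :=
  generated_subalgebra
    (fun x => exists i, [\/ x = e_vec i, x = f_vec i | x = h_vec i]).

End InsideWeyl.

(* Main.v *)
Require Import Defs.
From HB Require Import structures.
From mathcomp Require Import all_boot all_order all_algebra.
From mathcomp Require Import reals complex boolp ring zify.

Set Implicit Arguments.
Unset Strict Implicit.
Unset Printing Implicit Defensive.

Import Order.TTheory GRing.Theory Num.Theory.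
Local Open Scope ring_scope.

(** Write e, f, h for the sl_2 currents of the statement, and H^(i) for the
    trace currents that commute with them. The Sugawara vectors of sl_2 at level
    -1 and of the H^(i) add up to the conformal vector of the Weyl vertex
    algebra: this is the conformal embedding of gl_2 at level -1 in two pairs of
    symplectic bosons ([gl2_casimir]).

    Let v be in the commutant of the sl_2 currents inside the whole Weyl vertex
    algebra. All nonnegative modes of the currents, hence of their Casimir
    vectors, kill v. So four times the conformal weight operator, plus the
    squares of the charges H^(i)(0), acts on v as minus two times the sum of the
    H^(i)(-n) H^(i)(n) over n > 0 ([weyl_energy_commutant]). The left hand side
    is diagonal on words in the a_i^+ and a_i^-, its eigenvalues are natural
    numbers, and zero occurs on the vacuum only. By induction on the eigenvalue,
    v is a combination of words in the H^(i) applied to the vacuum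
    ([heisenberg_energy_induction]). It is essential here that the H^(i) have
    negative norm: the squares of the charges then enter with the same sign as
    the conformal weight. Conversely words in the H^(i) are in the commutant,
    which gives [sl2_commutantE].

    In terms of the letters b, the subalgebra called the tensor square of the
    fixed points consists of the combinations of words with an even number of
    letters of each of the two kinds ([affine_C_squareE]). Each H^(i) is odd in
    both kinds ([heis_vec_b]). So the commutant consists of the combinations of
    words of even length in the H^(i) ([commutantE]); different parities are
    independent because they are parities of integer charges
    ([gspan_disjoint]).

    It remains to identify these words with those of the free boson vertex
    algebra. In the product of the two vertex algebras, the pairs of
    corresponding generators again satisfy the Heisenberg relations and generate
    a Fock space, which is irreducible by the same energy argument
    ([fock_irreducible]). Therefore this subalgebra of the product is the graph
    of an isomorphism, which preserves the parity of words and so restricts to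
    even words ([heisenberg_even_isomorphic]). *)

(** * Modes of a vertex algebra *)

Section Modes.
Variables (K : fieldType) (V : vertexAlgebra K).
Implicit Types (u v w x : V) (n p q r : int).

HB.instance Definition _ n u :=
  GRing.isLinear.Build K V V *:%R (vprod n u) (vprod_linearr n u).

Definition mode_at n v u : V := vprod n u v.

HB.instance Definition _ n v :=
  GRing.isLinear.Build K V V *:%R (mode_at n v) (vprod_linearl n v).

Lemma vprodDl n u1 u2 v : vprod n (u1 + u2) v = vprod n u1 v + vprod n u2 v.
Proof. exact: (linearD (mode_at n v)). Qed.

Lemma vprodNl n u v : vprod n (- u) v = - vprod n u v.
Proof. exact: (linearN (mode_at n v)). Qed.

Lemma vprodZl n c u v : vprod n (c *: u) v = c *: vprod n u v.
Proof. exact: (linearZZ (mode_at n v)). Qed.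

Lemma vprod0l n v : vprod n 0 v = 0.
Proof. exact: (linear0 (mode_at n v)). Qed.

Lemma vprod_suml I (s : seq I) (P : pred I) (F : I -> V) n v :
  vprod n (\sum_(i <- s | P i) F i) v = \sum_(i <- s | P i) vprod n (F i) v.
Proof. exact: (linear_sum (mode_at n v)). Qed.

Lemma vprodDr n u v1 v2 : vprod n u (v1 + v2) = vprod n u v1 + vprod n u v2.
Proof. exact: linearD. Qed.

Lemma vprodNr n u v : vprod n u (- v) = - vprod n u v.
Proof. exact: linearN. Qed.

Lemma vprodZr n u c v : vprod n u (c *: v) = c *: vprod n u v.
Proof. exact: linearZZ. Qed.

Lemma vprod0r n u : vprod n u 0 = 0.
Proof. exact: linear0. Qed.

Definition vprodE := (vprodDl, vprodNl, vprodZl, vprod0l,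
                      vprodDr, vprodNr, vprodZr, vprod0r).

Lemma binz0 p : binz p 0 = 1.
Proof. by case: p => n /=; rewrite bin0. Qed.

Lemma binz1 p : binz p 1 = p.
Proof. by case: p => n /=; rewrite bin1 // expr1 addn1 NegzE mulN1r. Qed.

Lemma binz0S i : binz 0 i.+1 = 0.
Proof. by rewrite /= bin0n. Qed.

(** The commutator formula [u_p, v_q] = \sum_i binz p i (u_i v)_(p+q-i) in the
    only case needed below, that of an operator product with a pole of order at
    most two. *)
Lemma commutator p q u v w :
    (forall i : nat, (1 < i)%N -> vprod i u v = 0) ->
  vprod p u (vprod q v w) - vprod q v (vprod p u w) =
  vprod (p + q) (vprod 0 u v) w
  + p%:~R *: vprod (p + q - 1) (vprod 1 u v) w.
Proof.
move=> uv0; have [N0 /(_ N0.+2)] := borcherds p q 0 u v w.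
rewrite -addn2 leq_addr addn2 => /(_ isT).
rewrite !big_ord_recl big1 ?addr0 => [|i _]; last first.
  by rewrite add0r uv0 // vprod0l scaler0.
rewrite [X in _ + (_ + X)]big1 ?addr0 => [|i _]; last first.
  by rewrite binz0S mulr0 scale0r.
rewrite binz0S mulr0 scale0r addr0 !binz0 binz1.
rewrite /= /bump /= addn0 !add0r.
by rewrite expr0 mulr1 expr0z !scale1r => <-.
Qed.

Lemma commute_modes p q u v w : (forall i : nat, vprod i u v = 0) ->
  vprod p u (vprod q v w) = vprod q v (vprod p u w).
Proof.
move=> uv0; apply/eqP; rewrite -subr_eq0 commutator => [|i _]; last exact: uv0.
by rewrite (uv0 0) (uv0 1) !vprod0l scaler0 addr0.
Qed.

Lemma iterate r q u v w : exists N0, forall N, (N0 <= N)%N ->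
  vprod q (vprod r u v) w =
  \sum_(i < N) ((-1) ^+ i * (binz r i)%:~R) *:
    (vprod (r - i%:Z) u (vprod (q + i%:Z) v w) -
     (-1) ^ r *: vprod (q + r - i%:Z) v (vprod i u w)).
Proof.
have [N0 H] := borcherds 0 q r u v w; exists N0.+1 => N leN.
have := H N (ltnW leN); case: N leN => // N _.
rewrite big_ord_recl binz0 scale1r subr0 addr0 add0r.
rewrite big1 ?addr0 => [->|i _]; last by rewrite binz0S scale0r.
by apply: eq_bigr => i _; rewrite !add0r.
Qed.

(** (u_(-2) 1)(z) is the derivative of the field u(z). *)
Lemma derivative_mode n u w :
  vprod n (vprod (-2) u vacuum) w = - n%:~R *: vprod (n - 1) u w.
Proof.
have [N0 H] := iterate (-2) n u vacuum w.
have binN2 i : ((-1) ^+ i * (binz (-2) i)%:~R) = (i.+1)%:R :> K.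
  rewrite /= add1n binSn rmorphM /= rmorphXn /= rmorphN1 mulrA -expr2.
  by rewrite sqrr_sign mul1r.
have [N leN0N] : exists2 N, (N0 <= N)%N & (`|n| < N)%N.
  by exists (N0 + `|n|.+1)%N; [exact: leq_addr | rewrite ltn_addl].
rewrite {H}(H N leN0N).
have sgnN2 : (-1) ^ (-2) = 1 :> K by rewrite /exprz /= expr2 mulrNN mulr1 invr1.
rewrite sgnN2; case: n => m ltmN.
- have vac0 i : vprod (Posz m + Posz i) vacuum w = 0 by rewrite vprod_vacuuml.
  case: m ltmN vac0 => [|m] ltmN vac0.
    rewrite oppr0 scale0r big1 // => i _.
    rewrite vac0 linear0 vprod_vacuuml ifF ?scaler0 ?subr0 ?scaler0 //.
    by apply/eqP; lia.
  rewrite (bigD1 (Ordinal (ltnW ltmN : m < N)%N)) //= big1 ?addr0 =>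
    [|i /eqP neim].
    rewrite vac0 linear0 scale1r vprod_vacuuml ifT ?sub0r; last first.
      by apply/eqP; lia.
    by rewrite -[_ * _]/((-1) ^+ m * (binz (-2) m)%:~R) binN2 scaleNr scalerN;
       congr (- (_ *: vprod _ _ _)); lia.
  rewrite vac0 linear0 vprod_vacuuml ifF ?scaler0 ?subr0 ?scaler0 //.
  by apply/eqP=> eqi; apply: neim; apply: val_inj => /=; lia.
- have vac0 i x : vprod (Negz m - 2 - Posz i) vacuum x = 0.
    by rewrite vprod_vacuuml ifF //; apply/eqP; lia.
  rewrite (bigD1 (Ordinal (ltnW ltmN : m < N)%N)) //= big1 ?addr0 =>
    [|i /eqP neim].
    rewrite vac0 scaler0 subr0 vprod_vacuuml ifT; last by apply/eqP; lia.
    rewrite -[_ * _]/((-1) ^+ m * (binz (-2) m)%:~R) binN2.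
    by rewrite NegzE -rmorphN opprK; congr (_ *: vprod _ _ _); lia.
  rewrite vac0 vprod_vacuuml ifF ?linear0 ?scaler0 ?subr0 ?scaler0 ?addr0
    ?scaler0 //.
  by apply/eqP=> eqi; apply: neim; apply: val_inj => /=; lia.
Qed.
End Modes.

(** * Subspaces, spans and parity *)

Section Subspaces.
Variables (K : fieldType) (V : vertexAlgebra K) (S : V -> Prop).
Hypothesis subS : subspace S.

Lemma subspace0 : S 0. Proof. exact: subS.1. Qed.

Lemma subspaceZ c u : S u -> S (c *: u).
Proof. by move=> Su; rewrite -[_ *: _]addr0; apply: subS.2 => //;
  exact: subspace0. Qed.

Lemma subspaceD u v : S u -> S v -> S (u + v).
Proof. by move=> Su Sv; rewrite -[u]scale1r; exact: subS.2. Qed.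

Lemma subspaceN u : S u -> S (- u).
Proof. by rewrite -scaleN1r; exact: subspaceZ. Qed.

Lemma subspaceB u v : S u -> S v -> S (u - v).
Proof. by move=> Su /subspaceN; exact: subspaceD. Qed.

Lemma subspace_sum I (s : seq I) (P : pred I) (F : I -> V) :
  (forall i, P i -> S (F i)) -> S (\sum_(i <- s | P i) F i).
Proof. exact: (big_ind S subspace0 subspaceD). Qed.

End Subspaces.

Section Spans.
Variables (K : fieldType) (V : vertexAlgebra K).
Implicit Types (G S : V -> Prop) (u v w : V).

Lemma lin_span_gen G g : G g -> lin_span G g.
Proof. by move=> Gg S _; exact. Qed.

Lemma lin_span_subspace G : subspace (lin_span G).
Proof.
split=> [S [] // |c u v Su Sv S subS GS]; apply: subS.2.
  exact: Su.
exact: Sv.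
Qed.

Lemma subspace_preimage S (f : {linear V -> V}) :
  subspace S -> subspace (fun v => S (f v)).
Proof.
by move=> [S0 Slin]; split=> [|c u v Su Sv]; rewrite ?linear0 ?linearP; auto.
Qed.

(** By the iterate formula, the vectors whose field is regular against v form a
    subalgebra; so membership in a commutant is a condition on generators. *)
Lemma centralizer_subalgebra v :
  vertex_subalgebra (fun u => forall n : int, 0 <= n -> vprod n u v = 0).
Proof.
split.
- split=> [n _|c u w u0 w0 n n_ge0]; first exact: vprod0l.
  by rewrite !vprodE u0 ?w0 // scaler0 addr0.
- by move=> n n_ge0; rewrite vprod_vacuuml ifF //; apply/eqP; lia.
- move=> r u w u0 w0 n n_ge0; have [N /(_ N (leqnn _)) ->] := iterate r n u w v.
  apply: big1 => i _; rewrite w0 ?u0 //; last by lia.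
  by rewrite !linear0 addr0 linear0.
Qed.

End Spans.

Section GradedSpan.
Variables (K : fieldType) (V : vertexAlgebra K) (G : zmodType) (I : Type).
Variables (deg : I -> G) (x : I -> V).

(** The degree g part of the subalgebra generated by the x i; it is an
    inductive family, so that nothing has to be known about linear relations
    between words, which could a priori make the degrees overlap. *)
Inductive gspan : G -> V -> Prop :=
| gspan_zero g : gspan g 0
| gspan_vacuum : gspan 0 vacuum
| gspan_lin g c u v : gspan g u -> gspan g v -> gspan g (c *: u + v)
| gspan_mode g i n u : gspan g u -> gspan (deg i + g) (vprod n (x i) u).

Lemma gspan_subspace g : subspace (gspan g).
Proof. by split=> *; [exact: gspan_zero | exact: gspan_lin]. Qed.

Lemma gspan_gen i : gspan (deg i) (x i).
Proof.
rewrite -[x i]vprod_creationN1 -[deg i]addr0.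
exact/gspan_mode/gspan_vacuum.
Qed.

Lemma gspan_vprod n g h u v :
  gspan g u -> gspan h v -> gspan (g + h) (vprod n u v).
Proof.
move=> gu; elim: gu n h v =>
  {g u} [g||g c u w gu IHu gw IHw|g i r u gu IHu] n h v.
- by move=> _; rewrite vprod0l; exact: gspan_zero.
- by rewrite vprod_vacuuml add0r; case: ifP => // _ _; exact: gspan_zero.
- move=> hv; rewrite !vprodE.
  by apply: gspan_lin; [exact: IHu | exact: IHw].
move=> hv; have [N /(_ N (leqnn _)) ->] := iterate r n (x i) u v.
have subgh := gspan_subspace (deg i + g + h).
apply: subspace_sum => // j _; apply: subspaceZ => //; apply: subspaceB => //.
  by rewrite -addrA; apply: gspan_mode; exact: IHu.
apply: subspaceZ => //; rewrite [deg i + g]addrC -addrA.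
by apply: IHu; exact: gspan_mode.
Qed.

Lemma gspan0_subalgebra : vertex_subalgebra (gspan 0).
Proof.
split; [exact: gspan_subspace | exact: gspan_vacuum |] => n u v u0 v0.
by rewrite -[0]addr0; exact: gspan_vprod.
Qed.

End GradedSpan.

Section ParitySpan.
Variables (K : fieldType) (V : vertexAlgebra K) (I : Type) (x : I -> V).
Implicit Types (b : bool) (u v w : V).

Definition parity_span : bool -> V -> Prop := gspan (fun=> true) x.

Definition word_span v : Prop :=
  exists2 v0, parity_span false v0 & parity_span true (v - v0).

Lemma parity_word_span b v : parity_span b v -> word_span v.
Proof.
case: b => bv.
  by exists 0; rewrite ?subr0 //; exact: gspan_zero.
by exists v; rewrite ?subrr //; exact: gspan_zero.
Qed.

Lemma parity_span_mode b n i v :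
  parity_span b v -> parity_span (~~ b) (vprod n (x i) v).
Proof. exact: gspan_mode. Qed.

Lemma parity_span_vprod b c n u v :
  parity_span b u -> parity_span c v -> parity_span (b (+) c) (vprod n u v).
Proof. exact: gspan_vprod. Qed.

Lemma word_span_subspace : subspace word_span.
Proof.
split=> [|c u v [u0 u0P u1P] [v0 v0P v1P]].
  exact: parity_word_span (gspan_zero _ _ false).
exists (c *: u0 + v0); first exact: gspan_lin.
by rewrite opprD addrACA -scalerBr; exact: gspan_lin.
Qed.

Lemma word_span_subalgebra : vertex_subalgebra word_span.
Proof.
have subW := word_span_subspace; split=> //.
  exact: parity_word_span (gspan_vacuum _ _).
move=> n u v [u0 u0P u1P] [v0 v0P v1P].
rewrite -[u](subrK u0) -[v](subrK v0).
move: (u - u0) (v - v0) u1P v1P => u1 v1 u1P v1P; rewrite !vprodE.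
by apply: (subspaceD subW); apply: (subspaceD subW); apply: parity_word_span;
  apply: parity_span_vprod; eassumption.
Qed.

Lemma word_span_mode n i v : word_span v -> word_span (vprod n (x i) v).
Proof.
have [_ _ prodW] := word_span_subalgebra; apply: prodW.
exact: parity_word_span (gspan_gen _ _ i).
Qed.

Lemma word_span_ind (S : V -> Prop) : subspace S -> S vacuum ->
  (forall i n v, S v -> S (vprod n (x i) v)) -> forall v, word_span v -> S v.
Proof.
move=> subS Svac Smode v [v0 v0P v1P]; rewrite -[v](subrK v0).
suff Spar b u : parity_span b u -> S u.
  by apply: subspaceD => //; apply: Spar; eassumption.
elim=> {b u} // [*|*|*]; [exact: subspace0 | exact: subS.2 | exact: Smode].
Qed.

Lemma generated_word_span (G : V -> Prop) v :
    (forall g, G g <-> exists i, g = x i) ->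
  generated_subalgebra G v <-> word_span v.
Proof.
move=> GE; split=> [genv|wv S [subS Svac Sprod] GS].
  apply: genv => [|g /GE [i ->]]; first exact: word_span_subalgebra.
  exact: parity_word_span (gspan_gen _ _ i).
apply: word_span_ind wv => // i n u Su; apply: Sprod => //.
by apply/GS/GE; exists i.
Qed.

Section SignAutomorphism.
Variables (A G : V -> Prop).
Hypothesis two_neq0 : (2 : K) != 0.
Hypothesis Gx : forall i, G (x i).
Hypothesis G_odd : forall g, G g -> parity_span true g.
Hypothesis A_word : forall v, A v <-> word_span v.
Hypothesis parity_disjoint :
  forall v, parity_span false v -> parity_span true v -> v = 0.

Lemma sign_automorphismE (s : V -> V) b v :
    vertex_isomorphism A A s -> (forall g, G g -> s g = - g) ->
  parity_span b v -> s v = (-1) ^+ b *: v.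
Proof.
move=> [[s_lin s_vac s_prod] _] sG.
have Apar c u : parity_span c u -> A u by move=> cu;
  exact/A_word/parity_word_span/cu.
have s0 : s 0 = 0.
  have A0 : A 0 by apply: (Apar false); exact: gspan_zero.
  by have := s_lin (-1) 0 0 A0 A0; rewrite addr0 scaler0 scaleN1r addNr.
elim=> {b v} [b||b c u v bu IHu bv IHv|b i n u bu IHu].
- by rewrite s0 scaler0.
- by rewrite s_vac scale1r.
- rewrite s_lin; [|exact: Apar bu|exact: Apar bv].
  by rewrite IHu IHv scalerDr !scalerA mulrC.
rewrite s_prod; [|exact: Apar (gspan_gen _ _ i)|exact: Apar bu].
rewrite sG // IHu !vprodE.
by case: b {bu IHu}; rewrite /= ?expr0 ?expr1 ?scaleN1r ?scale1r ?opprK.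
Qed.

Lemma sign_automorphism_exists : exists s : V -> V,
  [/\ vertex_isomorphism A A s, forall g, G g -> s g = - g
    & forall v, parity_span false v -> s v = v].
Proof.
have even_sub := gspan_subspace (fun=> true : bool) x false.
have odd_sub := gspan_subspace (fun=> true : bool) x true.
have /choice [s sP] : forall v, exists y, A v -> exists v0 v1,
    [/\ parity_span false v0, parity_span true v1, v = v0 + v1 & y = v0 - v1].
  move=> v; have [/A_word [v0 v0P v1P]|nAv] := pselect (A v); last by exists 0.
  by exists (v0 - (v - v0)) => _; exists v0, (v - v0);
    rewrite [v0 + _]addrC subrK.
have sE v0 v1 : parity_span false v0 -> parity_span true v1 ->
    s (v0 + v1) = v0 - v1.
  move=> v0P v1P; have [|w0 [w1 [w0P w1P eqvw ->]]] := sP (v0 + v1).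
    apply/A_word/(subspaceD word_span_subspace);
    [exact: parity_word_span v0P | exact: parity_word_span v1P].
  have eq10 : v0 - w0 = w1 - v1.
    by apply/eqP; rewrite subr_eq addrAC -subr_eq opprK [w1 + _]addrC eqvw.
  have /eqP : v0 - w0 = 0.
    apply: parity_disjoint; first exact: subspaceB even_sub _ _ v0P w0P.
    by rewrite eq10; exact: subspaceB odd_sub _ _ w1P v1P.
  by rewrite subr_eq0 => /eqP eqv0; move: eqvw; rewrite eqv0 => /addrI ->.
have s_even v : parity_span false v -> s v = v.
  by move=> v0P; rewrite -[v in s v]addr0 sE ?subr0 //; exact: gspan_zero.
have s_odd v : parity_span true v -> s v = - v.
  by move=> v1P; rewrite -[v in s v]add0r sE ?sub0r //; exact: gspan_zero.
have sK v : A v -> A (s v) /\ s (s v) = v.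
  move=> /A_word [v0 v0P v1P]; rewrite -[v](subrK v0) addrC sE //.
  split; last by rewrite sE ?opprK //; exact: subspaceN odd_sub _ v1P.
  apply/A_word/(subspaceB word_span_subspace);
    [exact: parity_word_span v0P | exact: parity_word_span v1P].
exists s; split=> // [|g /G_odd]; last exact: s_odd.
split; split.
- move=> c u v /A_word [u0 u0P u1P] /A_word [v0 v0P v1P].
  rewrite -[u](subrK u0) -[v](subrK v0) ![_ - _ + _]addrC.
  move: (u - u0) (v - v0) u1P v1P => u1 v1 u1P v1P.
  rewrite scalerDr addrACA !sE //; try exact: gspan_lin.
  by rewrite scalerBr opprD addrACA.
- by apply: s_even; exact: gspan_vacuum.
- move=> n u v /A_word [u0 u0P u1P] /A_word [v0 v0P v1P].
  rewrite -[u](subrK u0) -[v](subrK v0) ![_ - _ + _]addrC.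
  move: (u - u0) (v - v0) u1P v1P => u1 v1 u1P v1P.
  have prodP b c := @parity_span_vprod b c n.
  rewrite !sE // !vprodE [vprod n u1 _ + _]addrC addrACA sE; last 2 first.
  + by apply: (subspaceD even_sub);
    [exact: (prodP false false)|exact: (prodP true true)].
  + by apply: (subspaceD odd_sub);
    [exact: (prodP false true)|exact: (prodP true false)].
  by rewrite opprD addrACA opprB.
- by move=> u /sK [].
- by move=> u v /sK [_ {2}<-] /sK [_ {2}<-] ->.
- by move=> v /sK [Asv ssv]; exists (s v).
Qed.

(** An automorphism acting by -1 on the generators must act by the parity on
    words, which determines its fixed points; the disjointness of the two
    parities is what makes such an automorphism exist. *)
Lemma sign_fixed_even v : sign_fixed A G v <-> parity_span false v.
Proof.
split=> [[Av [s [s_iso sG sv]]]|v0].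
  have [v0 v0P v1P] := (A_word v).1 Av.
  have [[s_lin _ _] _] := s_iso.
  move: sv; rewrite -[v](subrK v0); move: (v - v0) v1P => v1 v1P.
  rewrite -[v1]scale1r s_lin; last 2 first.
  - exact/A_word/parity_word_span/v1P.
  - exact/A_word/parity_word_span/v0P.
  rewrite (sign_automorphismE s_iso sG v1P) (sign_automorphismE s_iso sG v0P).
  rewrite !scale1r expr1 scaleN1r => /addIr /eqP.
  rewrite eq_sym -addr_eq0 -mulr2n -scaler_nat scaler_eq0 (negPf two_neq0) /=.
  by move=> /eqP ->; rewrite add0r.
split; first exact/A_word/parity_word_span/v0.
have [s [s_iso sG s_even]] := sign_automorphism_exists.
by exists s; split=> //; exact: s_even.
Qed.

End SignAutomorphism.
End ParitySpan.

(** * Energy decompositions *)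

Section Energy.
Variables (K : numFieldType) (V : vertexAlgebra K) (T : {linear V -> V}).
Implicit Types (u v w : V) (S : V -> Prop).

(** Applying T - mu N removes the last summand and multiplies the others by
    nonzero scalars. *)
Lemma eigen_components (mu : nat -> K) S N (f : nat -> V) :
    subspace S -> (forall v, S v -> S (T v)) -> injective mu ->
    (forall k, T (f k) = mu k *: f k) ->
  S (\sum_(k < N) f k) -> forall k, (k < N)%N -> S (f k).
Proof.
move=> subS ST inj_mu; elim: N f => // N IHN f Tf Sf.
have Sfk k : (k < N)%N -> S (f k).
  move=> ltkN; suff /(subspaceZ subS (mu k - mu N)^-1) :
      S ((mu k - mu N) *: f k).
    rewrite scalerA mulVf ?scale1r //.
    by rewrite subr_eq0; apply/eqP=> /inj_mu eqkN; rewrite eqkN ltnn in ltkN.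
  apply: (IHN (fun k => (mu k - mu N) *: f k)) => // [j|].
    by rewrite linearZZ Tf !scalerA mulrC.
  have /(subspaceB subS) /(_ (subspaceZ subS (mu N) Sf)) := ST _ Sf.
  rewrite linear_sum scaler_sumr -sumrB big_ord_recr /= Tf subrr addr0.
  by congr S; apply: eq_bigr => j _; rewrite Tf scalerBl.
move=> k; rewrite ltnS leq_eqVlt => /predU1P[->|/Sfk //].
rewrite big_ord_recr /= in Sf.
rewrite -[f N](addKr (\sum_(k < N) f k)) addrC; apply: subspaceB => //.
by apply: subspace_sum => // i _; exact: Sfk.
Qed.

(** The last clause asks for all large N' rather than for one N, so that two
    decompositions can be added without truncating either of them. *)
Definition energy_sum v : Prop := exists (f : nat -> V) N,
  [/\ forall k, T (f k) = k%:R *: f k, exists c, f 0 = c *: vacuum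
    & forall N', (N <= N')%N -> v = \sum_(k < N') f k].

Lemma energy_sum_subspace : subspace energy_sum.
Proof.
split.
  exists (fun=> 0), 0; split=> [k||N _]; rewrite ?linear0 ?scaler0 //.
    by exists 0; rewrite scale0r.
  by rewrite big1.
move=> c u v [f [N [Tf [a f0] fE]]] [g [P [Tg [b g0] gE]]].
exists (fun k => c *: f k + g k), (maxn N P); split=> [k||N'].
- by rewrite linearP Tf Tg scalerDr !scalerA mulrC.
- by exists (c * a + b); rewrite f0 g0 scalerDl scalerA.
rewrite geq_max => /andP[leN leP].
by rewrite (fE _ leN) (gE _ leP) scaler_sumr big_split.
Qed.

Lemma energy_sum_eigenvector v k : T v = k%:R *: v ->
  (k = 0 -> exists c, v = c *: vacuum) -> energy_sum v.
Proof.
move=> Tv v0; exists (fun j => if j == k then v else 0), k.+1; split=> [j||N'].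
- by case: eqP => [->|_]; rewrite ?linear0 ?scaler0.
- case: eqP => [/esym/v0 //|_]; by exists 0; rewrite scale0r.
move=> lekN; rewrite (bigD1 (Ordinal lekN)) //= eqxx big1 ?addr0 // => i neik.
by rewrite ifF //; apply/eqP => eqik; case/eqP: neik; exact: val_inj.
Qed.

Lemma energy_sum_spectrum v mu : energy_sum v -> T v = mu *: v ->
  (forall k : nat, (0 < k)%N -> k%:R != mu) -> exists c, v = c *: vacuum.
Proof.
move=> [f [N [Tf [c f0] fE]]] Tv muP; exists c.
have sub0 : subspace (fun v : V => v = 0).
  by split=> // a u w -> ->; rewrite scaler0 addr0.
have f_pos k : (k < N.+1)%N -> (0 < k)%N -> f k = 0.
  move=> ltkN k_gt0; apply/eqP; rewrite -[_ == 0]orFb.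
  rewrite -[X in X || _](negPf (muP k k_gt0)) -subr_eq0 -scaler_eq0; apply/eqP.
  apply: (@eigen_components (fun k => k%:R) _ N.+1
    (fun k => (k%:R - mu) *: f k) sub0) => //.
  - by move=> _ ->; rewrite linear0.
  - by move=> i j /eqP; rewrite eqr_nat => /eqP.
  - by move=> j; rewrite linearZZ Tf !scalerA mulrC.
  transitivity (T v - mu *: v); last by rewrite Tv subrr.
  rewrite (fE N.+1) // linear_sum scaler_sumr -sumrB; apply: eq_bigr => j _.
  by rewrite Tf scalerBl.
rewrite (fE N.+1) // big_ord_recl big1 ?addr0 // => i _.
by apply: f_pos => //; rewrite /= /bump ltnS; case: i.
Qed.

End Energy.

Section CreationSpan.
Variables (K : fieldType) (V : vertexAlgebra K) (I : Type) (y : I -> V).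

Definition creation_word (s : seq (I * nat)) : V :=
  foldr (fun ik w => vprod (- ik.2.+1%:Z) (y ik.1) w) vacuum s.

Definition creation_span : V -> Prop :=
  lin_span (fun v => exists s, v = creation_word s).

Lemma creation_word_span s : creation_span (creation_word s).
Proof. by apply: lin_span_gen; exists s. Qed.

(** Annihilation modes are moved to the right, where they kill the vacuum. *)
Lemma creation_span_mode i n v :
    (forall i j (m : nat) n, exists c, forall w,
       vprod m (y i) (vprod n (y j) w) - vprod n (y j) (vprod m (y i) w)
       = c *: w) ->
  creation_span v -> creation_span (vprod n (y i) v).
Proof.
move=> comm; have subC :=
  lin_span_subspace (fun v => exists s, v = creation_word s).
have create j (m : nat) w : creation_span w ->
  creation_span (vprod (- m.+1%:Z) (y j) w).
  move=> spanw; apply: (spanw (fun w => creation_span (vprod _ (y j) w))).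
    exact: (subspace_preimage (vprod _ (y j)) subC).
  by move=> _ [s ->]; exact: (creation_word_span ((j, m) :: s)).
case: n => n; last by rewrite NegzE; exact: create.
move=> spanv; apply: (spanv (fun v => creation_span (vprod n (y i) v))).
  exact: (subspace_preimage (vprod n (y i)) subC).
move=> _ [s ->]; elim: s => [|[j m] s IHs] /=.
  by rewrite vprod_creation //; exact: (subspace0 subC).
have [c /(_ (creation_word s)) /eqP] := comm i j n (- m.+1%:Z).
rewrite subr_eq => /eqP ->; apply: (subspaceD subC); last exact: create.
by apply: (subspaceZ subC); exact: creation_word_span.
Qed.

End CreationSpan.

Lemma creation_energy (K : numFieldType) (V : vertexAlgebra K) (I : Type)
    (y : I -> V) (T : {linear V -> V}) (d : seq (I * nat) -> nat) v :
    (forall s, T (creation_word y s) = (d s)%:R *: creation_word y s) ->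
    (forall s, d s = 0 -> s = [::]) ->
  creation_span y v -> energy_sum T v.
Proof.
move=> Td d0; apply; first exact: energy_sum_subspace.
move=> _ [s ->]; apply: (@energy_sum_eigenvector _ _ _ _ (d s)) => // /d0 ->.
by exists 1; rewrite scale1r.
Qed.

(** * Heisenberg families *)

Section HeisenbergFamily.
Variables (K : numFieldType) (V : vertexAlgebra K) (l : nat) (z : 'I_l -> V).
Implicit Types (i j : 'I_l) (u v w : V).

Definition heisenberg_family : Prop := forall i j (n : nat),
  vprod n (z i) (z j) = if (n == 1) && (i == j) then - 2 *: vacuum else 0.

Hypothesis heis_z : heisenberg_family.

Lemma heisenberg_commutator i j m n v :
  vprod m (z i) (vprod n (z j) v) - vprod n (z j) (vprod m (z i) v) =
  if (i == j) && (m + n == 0) then (- 2 * m%:~R) *: v else 0.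
Proof.
rewrite commutator => [|k k_gt1]; last by rewrite heis_z; case: k k_gt1 =>
  [|[]].
rewrite !heis_z /= vprod0l add0r; case: eqP => _;
  last by rewrite vprod0l scaler0.
rewrite vprodZl vprod_vacuuml subr_eq addNr /=.
by case: eqP => _; rewrite ?scaler0 // scalerA mulrC.
Qed.

Definition heisenberg_square i : V := vprod (-1) (z i) (z i).

(** The Sugawara vector is - 1/4 times the sum of the squares, as the z i have
    norm - 2. This operator is four times the corresponding conformal weight,
    with the contribution of the charges z_i(0) removed. *)
Definition heisenberg_energy v : V :=
  \sum_i (vprod 0 (z i) (vprod 0 (z i) v) - vprod 1 (heisenberg_square i) v).

Lemma heisenberg_energy_linear : linear heisenberg_energy.
Proof.
move=> c u v; rewrite /heisenberg_energy scaler_sumr -big_split.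
by apply: eq_bigr => i _; rewrite !vprodE scalerBr opprD addrACA.
Qed.

HB.instance Definition _ := GRing.isLinear.Build K V V *:%R
  heisenberg_energy heisenberg_energy_linear.

(** The normally ordered form of the operator: minus two times the sum of the
    z_i(-n) z_i(n) over n > 0. *)
Lemma heisenberg_energy_sub (S : V -> Prop) v : subspace S ->
    (forall i (n : nat), S (vprod (- n.+1%:Z) (z i) (vprod n.+1 (z i) v))) ->
  S (heisenberg_energy v).
Proof.
move=> subS Szz; apply: subspace_sum => // i _.
have [N /(_ N.+1 (leqnSn _)) ->] := iterate (-1) 1 (z i) (z i) v.
have binN1 (k : nat) : (-1) ^+ k * (binz (-1) k)%:~R = 1 :> K.
  rewrite /= add0n binn mulr1 rmorphXn /= rmorphN1 -expr2 sqrr_sign //.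
under eq_bigr => k _ do rewrite binN1 scale1r exprN1 invrN1 scaleN1r opprK.
rewrite big_split /= [\sum_(k < _) vprod (1 - 1 - _) _ _]big_ord_recl /=.
rewrite addrCA opprD addNKr; apply: (subspaceN subS); apply: (subspaceD subS).
  apply: subspace_sum => // k _; have := Szz i k.
  by congr (S (vprod _ _ (vprod _ _ _))); lia.
apply: subspace_sum => // k _; have := Szz i k.
by congr (S (vprod _ _ (vprod _ _ _))); rewrite /bump /=; lia.
Qed.

Lemma heisenberg_energy_mode n i v :
  heisenberg_energy (vprod n (z i) v) =
  vprod n (z i) (heisenberg_energy v) - (4 * n%:~R) *: vprod n (z i) v.
Proof.
have zero_mode j w :
  vprod 0 (z j) (vprod n (z i) w) = vprod n (z i) (vprod 0 (z j) w).
  by apply/eqP; rewrite -subr_eq0 heisenberg_commutator mulr0 scale0r if_same.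
have square j (m : nat) : vprod m (z i) (heisenberg_square j) =
    if (m == 1) && (i == j) then - 4 *: z j else 0.
  have /eqP := heisenberg_commutator i j m (-1) (z j).
  rewrite subr_eq => /eqP ->; rewrite heis_z subr_eq0 eqz_nat andbC.
  case: (m =P 1) => [->|_]; last by rewrite !vprodE add0r.
  case: eqP => _ /=; last by rewrite !vprodE add0r.
  by rewrite !vprodE vprod_creationN1 -scalerDl; congr (_ *: _); ring.
transitivity (\sum_j (vprod n (z i) (vprod 0 (z j) (vprod 0 (z j) v)
    - vprod 1 (heisenberg_square j) v)
    - (if j == i then (4 * n%:~R) *: vprod n (z i) v else 0))).
  apply: eq_bigr => j _; rewrite !zero_mode !vprodE -addrA; congr (_ + _).
  have sq0 m : (1 < m)%N -> vprod m (z i) (heisenberg_square j) = 0.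
    by move=> m_gt1; rewrite square; case: m m_gt1 => [|[]].
  have /eqP := commutator n 1 v sq0.
  rewrite !square /= vprod0l add0r addrK subr_eq => /eqP ->.
  rewrite opprD addrAC -[LHS]add0r; congr (_ + _).
  rewrite eq_sym; case: eqP => [->|_];
    rewrite !vprodE ?scaler0 ?subr0 ?oppr0 //.
  by rewrite scalerA -opprD -scalerDl [X in X *: _](_ : _ = 0) ?scale0r
    ?oppr0 //; ring.
by rewrite sumrB -linear_sum -big_mkcond big_pred1_eq.
Qed.

(** If v is in S and has energy k > 0, then k v is a combination of vectors
    z_i(-n) z_i(n) v with n > 0, where z_i(n) v is in S and has energy k - 4n.
    So membership in Q descends to multiples of the vacuum. T may differ from
    the Heisenberg energy outside S: this lets a larger algebra provide the
    spectrum. *)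
Lemma heisenberg_energy_induction (T : {linear V -> V}) (S Q : V -> Prop) :
    subspace S -> subspace Q ->
    (forall i n v, S v -> S (vprod n (z i) v)) ->
    (forall i n v, Q v -> Q (vprod n (z i) v)) ->
    (forall v, S v -> energy_sum T v) ->
    (forall v, S v -> T v = heisenberg_energy v) ->
    (forall c, S (c *: vacuum) -> Q (c *: vacuum)) ->
  forall v, S v -> Q v.
Proof.
move=> subS subQ Sz Qz Sdec TE SQvac.
have ST v : S v -> S (T v).
  by move=> Sv; rewrite TE //; apply: (heisenberg_energy_sub subS) => i n;
    apply/Sz/Sz.
have Tmode i n v (c : K) : S v -> T v = c *: v ->
    T (vprod n (z i) v) = (c - 4 * n%:~R) *: vprod n (z i) v.
  move=> Sv Tv; rewrite TE ?heisenberg_energy_mode -?TE //; last exact: Sz.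
  by rewrite Tv vprodZr scalerBl.
have vacQ v mu : S v -> T v = mu *: v ->
    (forall k : nat, (0 < k)%N -> k%:R != mu) -> Q v.
  move=> Sv Tv muP; have [c cE] := energy_sum_spectrum (Sdec v Sv) Tv muP.
  by move: Sv; rewrite cE; exact: SQvac.
have eigenQ k v : S v -> T v = k%:R *: v -> Q v.
  elim/ltn_ind: k v => -[_|k IHk] v Sv Tv.
    by apply: vacQ Tv _ => // k; rewrite pnatr_eq0; case: k.
  suff /(subspaceZ subQ k.+1%:R^-1) : Q (k.+1%:R *: v).
    by rewrite scalerA mulVf ?scale1r ?pnatr_eq0.
  rewrite -Tv TE //; apply: (heisenberg_energy_sub subQ) => i n; apply: Qz.
  have Tzv := Tmode i n.+1 v _ Sv Tv; have Szv := Sz i n.+1 v Sv.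
  have [le4n|lt4n] := leqP (4 * n.+1) k.+1.
    apply: (IHk (k.+1 - 4 * n.+1)%N) => //; first by lia.
    by rewrite Tzv natrB // natrM.
  apply: vacQ Szv Tzv _ => m m_gt0; apply/eqP => meq.
  have /eqP : (m + 4 * n.+1)%:R = k.+1%:R :> K by rewrite natrD natrM meq subrK.
  by rewrite eqr_nat => /eqP; lia.
move=> v Sv; have [f [N [Tf _ fE]]] := Sdec v Sv.
rewrite (fE N) //; apply: subspace_sum => // k _; apply: (eigenQ k) => //.
apply: (eigen_components subS ST _ Tf _ (ltn_ord k)); last by rewrite -fE.
by move=> a b /eqP; rewrite eqr_nat => /eqP.
Qed.


(** The Fock space generated by the vacuum is irreducible: its only vectors of
    energy zero are the multiples of the vacuum, and the energy argument brings
    every vector down to them. *)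
Lemma fock_irreducible (S : V -> Prop) : subspace S ->
    (forall v, S v -> word_span z v) ->
    (forall i n v, S v -> S (vprod n (z i) v)) -> ~ S vacuum ->
  forall v, S v -> v = 0.
Proof.
move=> subS Sword Sz Nvac.
pose d (s : seq ('I_l * nat)) := (\sum_(ik <- s) 4 * ik.2.+1)%N.
apply: (heisenberg_energy_induction (T := heisenberg_energy) subS _ Sz) => //.
- by split=> // c u v -> ->; rewrite scaler0 addr0.
- by move=> i n _ ->; rewrite vprod0r.
- move=> v /Sword wv; apply: (@creation_energy _ _ _ z _ d) => [s|[//|ik s] |].
  + elim: s => [|[i k] s IHs]; rewrite /d ?big_nil ?big_cons /=.
      rewrite scale0r /heisenberg_energy big1 // => i _.
      by rewrite !vprod_creation // vprod0r subr0.
    rewrite heisenberg_energy_mode IHs vprodZr -scalerBl; congr (_ *: _).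
    by rewrite rmorphN mulrN opprK addrC natrD natrM.
  + by rewrite /d big_cons.
  apply: (word_span_ind (S := creation_span z)) wv => [||i n w].
  + exact: lin_span_subspace.
  + exact: (creation_word_span [::]).
  have comm i' j (m : nat) p : exists c, forall w',
      vprod m (z i') (vprod p (z j) w') - vprod p (z j)
        (vprod m (z i') w') = c *: w'.
    exists (if (i' == j) && (m%:Z + p == 0) then - 2 * m%:R else 0) => w'.
    by rewrite heisenberg_commutator; case: ifP => _; rewrite ?scale0r.
  exact: creation_span_mode comm.
- move=> c Sc; apply/eqP; rewrite scaler_eq0; apply/orP; left; apply/negPn/negP.
  move=> c_neq0; apply: Nvac; rewrite -[vacuum]scale1r -(mulVf c_neq0) -scalerA.
  exact: subspaceZ.
Qed.

End HeisenbergFamily.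

(** * The product of two vertex algebras *)

Section VertexProduct.
Variables (K : fieldType) (V W : vertexAlgebra K).
Implicit Types u v w : (V * W)%type.

Definition pair_prod (n : int) u v : V * W :=
  (vprod n u.1 v.1, vprod n u.2 v.2).

Fact pair_prod_linearr n u : linear (pair_prod n u).
Proof. by move=> c v w; rewrite /pair_prod /= !linearP. Qed.

Fact pair_prod_linearl n v : linear (fun u => pair_prod n u v).
Proof. by move=> c u w; rewrite /pair_prod /= !vprodE. Qed.

Fact pair_prod_trunc u v :
  exists N : int, forall n, N <= n -> pair_prod n u v = 0.
Proof.
have [N1 u0] := vprod_trunc u.1 v.1; have [N2 u0'] := vprod_trunc u.2 v.2.
exists (Num.max N1 N2) => n; rewrite ge_max => /andP[/u0 e1 /u0' e2].
by rewrite /pair_prod e1 e2.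
Qed.

Fact pair_prod_vacuuml n v :
  pair_prod n (vacuum, vacuum) v = if n == -1 then v else 0.
Proof.
by case: v => v w; rewrite /pair_prod /= !vprod_vacuuml; case: ifP.
Qed.

Fact pair_prod_creation n u : 0 <= n -> pair_prod n u (vacuum, vacuum) = 0.
Proof. by move=> n_ge0; rewrite /pair_prod /= !vprod_creation. Qed.

Fact pair_prod_creationN1 u : pair_prod (-1) u (vacuum, vacuum) = u.
Proof. by case: u => u w; rewrite /pair_prod /= !vprod_creationN1. Qed.

Fact pair_prod_borcherds (p q r : int) u v w : exists N0 : nat, forall N : nat,
  (N0 <= N)%N ->
  \sum_(i < N) (binz p i)%:~R *:
      pair_prod (p + q - i%:Z) (pair_prod (r + i%:Z) u v) w =
  \sum_(i < N) ((-1) ^+ i * (binz r i)%:~R) *: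
      (pair_prod (p + r - i%:Z) u (pair_prod (q + i%:Z) v w) -
       (-1) ^ r *: pair_prod (q + r - i%:Z) v (pair_prod (p + i%:Z) u w)).
Proof.
have [N1 B1] := borcherds p q r u.1 v.1 w.1.
have [N2 B2] := borcherds p q r u.2 v.2 w.2.
exists (maxn N1 N2) => N; rewrite geq_max => /andP[/B1 {}B1 /B2 {}B2].
apply: injective_projections; rewrite ?(raddf_sum fst) ?(raddf_sum snd).
  exact: B1.
exact: B2.
Qed.

Definition vertex_product : vertexAlgebra K :=
  VertexAlgebra pair_prod_linearr pair_prod_linearl pair_prod_trunc
    pair_prod_vacuuml pair_prod_creation pair_prod_creationN1
    pair_prod_borcherds.

End VertexProduct.

(** * Weyl families *)

Section WeylFamily.
Variables (K : numFieldType) (V : vertexAlgebra K) (J : finType).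
Variable y : J * bool -> V.
Implicit Types (a b c d : J * bool) (i j k : J) (v w : V).

Definition weyl_form c d : K := if c.1 == d.1 then c.2%:R - d.2%:R else 0.

(** (j, true) and (j, false) stand for a_j^+ and a_j^-. *)
Definition weyl_family : Prop := forall c d (n : nat),
  vprod n (y c) (y d) = if n == 0 then weyl_form c d *: vacuum else 0.

Hypothesis weyl_y : weyl_family.

Lemma weyl_commutator c d m n v :
  vprod m (y c) (vprod n (y d) v) - vprod n (y d) (vprod m (y c) v) =
  if m + n + 1 == 0 then weyl_form c d *: v else 0.
Proof.
rewrite commutator => [|p p_gt1]; last by rewrite weyl_y; case: p p_gt1.
rewrite !weyl_y /= vprod0l scaler0 addr0 vprodZl vprod_vacuuml addr_eq0.
by case: ifP => _; rewrite ?scaler0.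
Qed.

Lemma weyl_swap c d m n v : m + n + 1 != 0 ->
  vprod m (y c) (vprod n (y d) v) = vprod n (y d) (vprod m (y c) v).
Proof.
by move=> /negPf mn; apply/eqP; rewrite -subr_eq0 weyl_commutator mn.
Qed.

Lemma weyl_swap_form c d m n v : weyl_form c d = 0 ->
  vprod m (y c) (vprod n (y d) v) = vprod n (y d) (vprod m (y c) v).
Proof.
move=> cd0; apply/eqP; rewrite -subr_eq0 weyl_commutator cd0 scale0r.
by rewrite if_same.
Qed.

(** The quadratic vectors a_j^+ a_k^-, which span a copy of gl; conventions
    make a_j^+ a_k^- act on the a^+ as minus the matrix unit at (j, k). *)
Definition gl_vector j k : V := vprod (-1) (y (j, true)) (y (k, false)).

Lemma gl_vectorE j k :
  gl_vector j k = vprod (-1) (y (k, false)) (y (j, true)).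
Proof.
rewrite /gl_vector -[y (k, _) in LHS]vprod_creationN1.
by rewrite -[y (j, _) in RHS]vprod_creationN1 weyl_swap.
Qed.

Lemma weyl_gl_products c j k (n : nat) : vprod n (y c) (gl_vector j k) =
  if n == 0 then
    weyl_form c (j, true) *: y (k, false) + weyl_form c (k, false) *: y
      (j, true)
  else 0.
Proof.
have /eqP := weyl_commutator c (j, true) n (-1) (y (k, false)).
rewrite subr_eq -/(gl_vector j k) => /eqP ->; rewrite addrNK eqz_nat weyl_y.
by case: eqP => _; rewrite !vprodE ?addr0 // vprod_creationN1.
Qed.

Lemma weyl_gl_commutator c j k m n v :
  vprod n (gl_vector j k) (vprod m (y c) v) =
  vprod m (y c) (vprod n (gl_vector j k) v)
  - (weyl_form c (j, true) *: vprod (m + n) (y (k, false)) v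
     + weyl_form c (k, false) *: vprod (m + n) (y (j, true)) v).
Proof.
have gl0 (p : nat) : (1 < p)%N -> vprod p (y c) (gl_vector j k) = 0.
  by rewrite weyl_gl_products; case: p.
have := commutator m n v gl0;
  rewrite !weyl_gl_products /= vprod0l scaler0 addr0.
by rewrite !vprodE => <-; rewrite subKr.
Qed.

(** The vector of the current which gives a_j^+ and a_j^- opposite charges. *)
Definition charge_vector (s : J -> K) : V := \sum_j s j *: gl_vector j j.

Definition charge (s : J -> K) c : K := if c.2 then - s c.1 else s c.1.

Lemma charge_commutator s c m n v :
  vprod n (charge_vector s) (vprod m (y c) v) =
  vprod m (y c) (vprod n (charge_vector s) v)
  + charge s c *: vprod (m + n) (y c) v.
Proof.
transitivity (\sum_j (vprod m (y c) (vprod n (s j *: gl_vector j j) v)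
    + (if j == c.1 then charge s c *: vprod (m + n) (y c) v else 0))).
  rewrite vprod_suml; apply: eq_bigr => j _.
  rewrite vprodZl weyl_gl_commutator !vprodE scalerBr; congr (_ + _).
  case: c => [k [|]]; rewrite /weyl_form /charge /= [k == j]eq_sym;
    case: eqP => [->|_].
  - by rewrite subrr subr0 scale0r scale1r add0r scaleNr.
  - by rewrite !scale0r addr0 scaler0 oppr0.
  - by rewrite subrr sub0r scale0r scaleN1r addr0 scalerN opprK.
  - by rewrite !scale0r addr0 scaler0 oppr0.
by rewrite big_split -linear_sum /= -vprod_suml -big_mkcond big_pred1_eq.
Qed.

Lemma charge_vector_vacuum s (n : nat) : vprod n (charge_vector s) vacuum = 0.
Proof. exact: vprod_creation. Qed.

Lemma charge_gl_products s j k (n : nat) :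
  vprod n (charge_vector s) (gl_vector j k) =
  if n == 0 then (s k - s j) *: gl_vector j k else
  if n == 1 then (- s j * (j == k)%:R) *: vacuum else 0.
Proof.
rewrite /gl_vector -[y (k, _)]vprod_creationN1 !charge_commutator.
rewrite charge_vector_vacuum vprod0r add0r /charge /=.
case: n => [|[|n]] /=.
- by rewrite !vprodE vprod_creationN1 -scalerDl.
- rewrite (_ : -1 + 1 = Posz 0) // vprod_creationN1 weyl_y
  vprod_creation // !vprodE scaler0 add0r.
  rewrite /weyl_form /= eq_sym scalerA.
  by case: eqP => _; rewrite ?mulr0 ?scale0r ?subr0.
rewrite (_ : -1 + n.+2%:Z = n.+1%:Z); last by lia.
by rewrite vprod_creationN1 weyl_y vprod_creation // !vprodE !scaler0 addr0.
Qed.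

Lemma charge_products s t (n : nat) :
  vprod n (charge_vector s) (charge_vector t) =
  if n == 1 then - (\sum_j s j * t j) *: vacuum else 0.
Proof.
rewrite {2}/charge_vector linear_sum /=.
case: (n =P 1) => [->|/eqP n_neq1].
  rewrite scaleNr scaler_suml -sumrN; apply: eq_bigr => j _.
  by rewrite vprodZr charge_gl_products /= eqxx mulr1 scalerA mulrN scaleNr
    mulrC.
apply: big1 => j _; rewrite vprodZr charge_gl_products subrr scale0r.
by rewrite (negPf n_neq1) if_same scaler0.
Qed.

(** Twice the conformal vector of one pair a_j^+, a_j^-. The mode of index 1 of
    the sum over j multiplies a word by twice its conformal weight. *)
Definition weyl_stress_at j : V :=
  vprod (-1) (y (j, true)) (vprod (-2) (y (j, false)) vacuum)
  - vprod (-1) (y (j, false)) (vprod (-2) (y (j, true)) vacuum).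

Definition weyl_stress : V := \sum_j weyl_stress_at j.

Lemma weyl_derivative_products a b c (n : nat) :
  vprod n (y c) (vprod (-1) (y a) (vprod (-2) (y b) vacuum)) =
  if n == 0 then weyl_form c a *: vprod (-2) (y b) vacuum else
  if n == 1 then weyl_form c b *: y a else 0.
Proof.
have /eqP := weyl_commutator c a n (-1) (vprod (-2) (y b) vacuum).
rewrite subr_eq => /eqP ->; have /eqP := weyl_commutator c b n (-2) vacuum.
rewrite subr_eq [vprod n _ vacuum]vprod_creation // vprod0r addr0 => /eqP ->.
rewrite addrNK eqz_nat (_ : n%:Z - 2 + 1 == 0 = (n == 1));
  last by apply/eqP/eqP; lia.
case: n => [|[|n]] /=; rewrite ?vprodE ?addr0 //.
by rewrite vprod_creationN1 add0r.
Qed.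

Lemma weyl_stress_commutator c m v :
  vprod 1 weyl_stress (vprod m (y c) v) =
  vprod m (y c) (vprod 1 weyl_stress v) - (2 * m%:~R + 1) *: vprod m (y c) v.
Proof.
pose st a b := vprod (-1) (y a) (vprod (-2) (y b) vacuum).
have st_comm a b : vprod 1 (st a b) (vprod m (y c) v) =
    vprod m (y c) (vprod 1 (st a b) v)
    + ((m + 1)%:~R * weyl_form c a) *: vprod m (y b) v
    - (m%:~R * weyl_form c b) *: vprod m (y a) v.
  have st0 (p : nat) : (1 < p)%N -> vprod p (y c) (st a b) = 0.
    by rewrite weyl_derivative_products; case: p => [|[]].
  have := commutator m 1 v st0; rewrite !weyl_derivative_products /=.
  rewrite addrK !vprodE derivative_mode addrK => stE.
  rewrite -[LHS](subKr (vprod m (y c) (vprod 1 (st a b) v))) stE !scalerA.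
  by rewrite mulrN scaleNr opprD opprK addrA [weyl_form c a * _]mulrC.
transitivity (\sum_j (vprod m (y c) (vprod 1 (weyl_stress_at j) v)
    - (if j == c.1 then (2 * m%:~R + 1) *: vprod m (y c) v else 0))).
  rewrite vprod_suml; apply: eq_bigr => j _.
  rewrite /weyl_stress_at -!/(st _ _) !vprodE !st_comm.
  case: c @st {st_comm} => [k [|]] st; rewrite /weyl_form /= [k == j]eq_sym;
    case: eqP => [->|_].
  - rewrite !subrr !subr0 !mulr0 !mulr1 !scale0r addr0 subr0.
    rewrite opprD addrACA -opprD -scalerDl; congr (_ - _ *: _).
    by rewrite rmorphD; ring.
  - by rewrite !mulr0 !scale0r !subr0 !addr0.
  - rewrite !subr0 !sub0r !mulr0 !mulrN1 !scale0r !scaleNr subr0 addr0 opprK.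
    rewrite opprD addrACA -opprD -scalerDl; congr (_ - _ *: _).
    by rewrite rmorphD; ring.
  - by rewrite !mulr0 !scale0r !subr0 !addr0.
by rewrite sumrB -linear_sum /= -vprod_suml -big_mkcond big_pred1_eq.
Qed.

End WeylFamily.

Section CasimirVector.
Variables (K : numFieldType) (V : vertexAlgebra K) (J : finType).
Variable y : J * bool -> V.
Hypothesis weyl_y : weyl_family y.

Lemma gl_vector_product (j k m n : J) :
  vprod (-1) (gl_vector y j k) (gl_vector y m n) =
  vprod (-1) (y (m, true)) (vprod (-1) (y (n, false)) (gl_vector y j k))
  - (if m == k then vprod (-1) (y (n, false)) (vprod (-2) (y (j, true)) vacuum)
     else 0)
  + (if n == j then vprod (-1) (y (m, true)) (vprod (-2) (y (k, false)) vacuum)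
     else 0).
Proof.
rewrite {2}/gl_vector -[y (n, _)]vprod_creationN1.
rewrite !(weyl_gl_commutator weyl_y) !vprodE vprod_creationN1.
rewrite vprod_creationN1 /weyl_form /= -!addrA; congr (_ + _).
rewrite addrC; congr (_ + _).
  rewrite subrr subr0 if_same scale0r add0r; congr (- _).
  case: eqP => _; rewrite ?scale0r // scale1r.
  by rewrite -[in LHS](vprod_creationN1 (y (n, false))) (weyl_swap weyl_y).
rewrite sub0r subrr if_same scale0r addr0.
by case: eqP => _; rewrite ?scaleN1r ?opprK // scale0r oppr0.
Qed.

(** The Sugawara construction for gl_2 at level -1, in the form needed here: up
    to the square of the trace current, the quadratic Casimir vector of sl_2 is
    the conformal vector of the Weyl algebra, because the quartic terms of the
    four products cancel. *)
Lemma gl2_casimir (j k : J) : j != k ->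
  vprod (-1) (gl_vector y j k) (gl_vector y k j)
  + vprod (-1) (gl_vector y k j) (gl_vector y j k)
  - vprod (-1) (gl_vector y j j) (gl_vector y k k)
  - vprod (-1) (gl_vector y k k) (gl_vector y j j) =
  weyl_stress_at y j + weyl_stress_at y k.
Proof.
move=> neq_jk; have neq_kj : k != j by rewrite eq_sym.
rewrite !gl_vector_product !eqxx (negPf neq_jk) (negPf neq_kj) !subr0 !addr0.
have create c d v : vprod (-1) (y c) (vprod (-1) (y d) v) =
    vprod (-1) (y d) (vprod (-1) (y c) v).
  exact: (weyl_swap weyl_y).
have quartic m n p q :
    vprod (-1) (y (m, true)) (vprod (-1) (y (n, false)) (gl_vector y p q)) =
    vprod (-1) (y (m, true)) (vprod (-1) (y (q, false)) (gl_vector y p n)).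
  by rewrite !(gl_vectorE weyl_y); congr (vprod _ _ _); exact: create.
rewrite [X in X - _ + _ + _](quartic k j j k) (quartic j k k j).
rewrite [LHS](AC (3*3*1*1) ((1*7)*(4*8)*(6*2)*(3*5))) /=.
by rewrite !subrr !add0r.
Qed.

End CasimirVector.

(** * Parity of charges *)

Section ChargeParity.
Variables (K : numFieldType) (V : vertexAlgebra K) (T : {linear V -> V}).
Implicit Types (r : seq int) (P : int -> Prop) (u v w : V).

Definition eigen_span P : V -> Prop :=
  lin_span (fun v => exists2 k : int, P k & T v = k%:~R *: v).

Let op r v := foldr (fun k w => T w - k%:~R *: w) v r.

Let op_linear r : linear (op r).
Proof.
elim: r => // k r IHr c u v /=; rewrite IHr linearP scalerDr scalerBr.
by rewrite opprD addrACA !scalerA mulrC.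
Qed.

Let op0 r : op r 0 = 0.
Proof. by have := op_linear r (-1) 0 0;
  rewrite scaleN1r oppr0 addr0 scaleN1r addNr. Qed.

Let op_T r v : op r (T v) = T (op r v).
Proof. elim: r => //= k r ->. by rewrite [RHS]linearB [in RHS]linearZZ. Qed.

Let op_step r k v : op r (T v - k%:~R *: v) = T (op r v) - k%:~R *: op r v.
Proof. by rewrite addrC -scaleNr op_linear op_T scaleNr addrC. Qed.

Let opC r r' v : op r (op r' v) = op r' (op r v).
Proof. by elim: r' => //= k r' IHr; rewrite op_step IHr. Qed.

Let op_eigen r k v : T v = k%:~R *: v ->
  op r v = (\prod_(j <- r) (k - j)%:~R) *: v.
Proof.
move=> Tv; elim: r => [|j r IHr] /=; first by rewrite big_nil scale1r.
rewrite IHr big_cons linearZZ Tv !scalerA -scalerBl; congr (_ *: _).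
by rewrite intrB; ring.
Qed.

(** Working with a product of factors T - k that kills v, instead of with a
    decomposition of v, spares the bookkeeping of its components. *)
Let annihilated P v := exists2 r, (forall k, k \in r -> P k) & op r v = 0.

Let eigen_span_annihilated P v : eigen_span P v -> annihilated P v.
Proof.
apply; last first.
  move=> u [k Pk Tu]; exists [:: k]; last by rewrite /= Tu subrr.
  by move=> j; rewrite inE => /eqP ->.
split=> [|c u w [r rP ru] [s sP sw]]; first by exists [::].
exists (r ++ s) => [k|]; first by rewrite mem_cat => /orP[/rP|/sP].
rewrite [op _ _]foldr_cat -/(op s _) -/(op r _) op_linear sw addr0.
by rewrite -[c *: _]addr0 op_linear op0 addr0 opC ru op0 scaler0.
Qed.

(** Let s annihilate v, and suppose that T w = k w for some w obtained from v by
    other factors. Then s acts on w by the product of the k - j over j in s,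
    which is nonzero, so w = 0. *)
Lemma eigen_span_disjoint P P' v : (forall k, P k -> P' k -> False) ->
  eigen_span P v -> eigen_span P' v -> v = 0.
Proof.
move=> PP' /eigen_span_annihilated [r rP rv] /eigen_span_annihilated [s sP sv].
elim: r rP rv => [//|k r IHr] rP rv; apply: IHr.
  by move=> j jr; apply: rP; rewrite inE jr orbT.
have Pk : P k by apply: rP; rewrite mem_head.
move: rv => /= /eqP; rewrite subr_eq0 => /eqP Tw.
have /esym/eqP := op_eigen s Tw; rewrite opC sv op0 scaler_eq0.
case/orP=> [|/eqP //]; rewrite prodf_seq_eq0 => /hasP[j js].
rewrite intr_eq0 subr_eq0 => /eqP eqkj.
by case: (PP' k Pk); rewrite eqkj; exact: sP.
Qed.

Section GradedByCharge.
Variables (G : zmodType) (I : Type) (deg : I -> G) (x : I -> V) (q : I -> int).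
Variable p : G -> bool.
Hypothesis p0 : p 0 = false.
Hypothesis pD : forall i g, p (deg i + g) = odd `|q i| (+) p g.
Hypothesis T_vacuum : T vacuum = 0.
Hypothesis T_mode : forall i n v,
  T (vprod n (x i) v) = vprod n (x i) (T v) + (q i)%:~R *: vprod n (x i) v.

Let gspan_eigen g v :
  gspan deg x g v -> eigen_span (fun k : int => odd `|k| = p g) v.
Proof.
elim=> {g v} [g||g c u v _ IHu _ IHv|g i n u _ IHu].
- exact: subspace0 (lin_span_subspace _).
- by apply: lin_span_gen; exists 0; rewrite ?p0 // T_vacuum scale0r.
- by apply: (lin_span_subspace _).2.
apply: (IHu (fun u => eigen_span _ (vprod n (x i) u))).
  exact: (subspace_preimage (vprod n (x i)) (lin_span_subspace _)).
move=> v [k /= kP Tv]; apply: lin_span_gen; exists (q i + k).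
  by rewrite pD -kP; lia.
by rewrite T_mode Tv vprodZr -scalerDl intrD addrC.
Qed.

(** A degree that can be read off from the parity of integer eigenvalues cuts
    out independent subspaces. *)
Lemma gspan_disjoint g h v : p g != p h ->
  gspan deg x g v -> gspan deg x h v -> v = 0.
Proof.
move=> /eqP neq_gh /gspan_eigen gv /gspan_eigen hv.
by apply: (eigen_span_disjoint _ gv hv) => k /= -> /neq_gh.
Qed.

End GradedByCharge.
End ChargeParity.

(** * Products of commuting subalgebras *)

Section CommutingModes.
Variables (K : fieldType) (V : vertexAlgebra K).
Implicit Types (u v w x : V).

Lemma gspan_sub_subalgebra (G : zmodType) (I : Type) (deg : I -> G) (x : I -> V)
    (S : V -> Prop) g v :
  vertex_subalgebra S -> (forall i, S (x i)) -> gspan deg x g v -> S v.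
Proof.
move=> [subS Svac Sprod] Sx; elim=> {g v} [*||*|*].
- exact: subspace0.
- exact: Svac.
- exact: subS.2.
- exact: Sprod.
Qed.

(** All terms of the iterate formula except the first involve a nonnegative mode
    acting on w. *)
Lemma tensor_mode_left n x u w :
    (forall i : nat, vprod i u w = 0) -> (forall i : nat, vprod i x w = 0) ->
  vprod (-1) (vprod n x u) w = vprod n x (vprod (-1) u w).
Proof.
move=> uw0 xw0; have [N /(_ N.+1 (leqnSn _)) ->] := iterate n (-1) x u w.
rewrite big_ord_recl big1 => [|i _].
  by rewrite binz0 mul1r scale1r xw0 vprod0r scaler0 !subr0 !addr0.
rewrite (_ : -1 + (lift ord0 i)%:Z = i) ?uw0 ?xw0 ?vprod0r ?scaler0 ?subrr
  ?scaler0 //.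
by rewrite /= /bump; lia.
Qed.

End CommutingModes.

(** * The commutant in the Weyl vertex algebra *)

Section InWeyl.
Variables (K : numClosedFieldType) (l : nat) (M : vertexAlgebra K).
Variables ap am : 'I_(l + l) -> int -> {linear M -> M}.
Hypothesis hM : weyl_vertex_algebra ap am.
Implicit Types (i : 'I_l) (j k : 'I_(l + l)) (c d : 'I_(l + l) * bool)
  (u v w : M).

Definition letter c : M :=
  if c.2 then ap c.1 (-1) vacuum else am c.1 (-1) vacuum.

Lemma letter_mode c n v :
  vprod n (letter c) v = if c.2 then ap c.1 n v else am c.1 n v.
Proof. by case: c => j [|];
  [exact: weyl_field_p hM _ _ _|exact: weyl_field_m hM _ _ _]. Qed.

Lemma weyl_letter : weyl_family letter.
Proof.
have vac0 j (n : nat) : ap j n vacuum = 0 /\ am j n vacuum = 0.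
  exact: weyl_vacuum hM _ _ _.
move=> [j b] [k b'] n; rewrite letter_mode /letter /weyl_form /=.
have eq_n0 : (n%:Z - 1 + 1 == 0) = (n == 0) by rewrite subrK.
have eq_0n : (- 1 + n%:Z + 1 == 0) = (n == 0) by rewrite addrAC addNr add0r.
case: b b' => -[].
- rewrite (weyl_pp hM) (vac0 j n).1 linear0 subrr.
  by rewrite if_same scale0r if_same.
- have := weyl_pm hM j k n (-1) vacuum.
  rewrite (vac0 j n).1 linear0 !subr0 => ->; rewrite eq_n0 andbC.
  by case: eqP => _ //=; case: eqP; rewrite ?scale1r ?scale0r.
- have /eqP := weyl_pm hM k j (-1) n vacuum.
  rewrite (vac0 j n).2 linear0 sub0r eqr_oppLR => /eqP ->.
  rewrite eq_0n andbC [k == j]eq_sym sub0r.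
  by case: ifP => [/andP[-> ->]|]; rewrite ?scaleN1r // oppr0;
    case: (n == 0); case: (j == k); rewrite ?scale0r.
- rewrite (weyl_mm hM) (vac0 j n).2 linear0 subrr.
  by rewrite if_same scale0r if_same.
Qed.

Lemma letters_span v : creation_span letter v.
Proof.
have comm c d (m : nat) n : exists a, forall w,
    vprod m (letter c) (vprod n (letter d) w)
    - vprod n (letter d) (vprod m (letter c) w) = a *: w.
  exists (if m%:Z + n + 1 == 0 then weyl_form K c d else 0) => w.
  by rewrite (weyl_commutator weyl_letter); case: ifP => _; rewrite ?scale0r.
apply: (weyl_generated hM (S := creation_span letter)) => [|j n w cw|].
- exact: lin_span_subspace.
- have := creation_span_mode (j, true) n comm cw.
  have := creation_span_mode (j, false) n comm cw.
  by rewrite !letter_mode.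
- exact: (creation_word_span [::]).
Qed.

Notation gl := (gl_vector letter).

Lemma idx_eq (i i' : 'I_l) : (idx i == idx i') = (i == i').
Proof. exact: (inj_eq (@lshift_inj _ _)). Qed.

Lemma idx'_eq (i i' : 'I_l) : (idx' i == idx' i') = (i == i').
Proof. by rewrite (inj_eq rev_ord_inj) idx_eq. Qed.

Lemma idx_idx' (i i' : 'I_l) : (idx i == idx' i') = false.
Proof.
by apply/eqP => /(congr1 val) /=; have := ltn_ord i; have := ltn_ord i'; lia.
Qed.

Lemma sum_pairs (U : zmodType) (F : 'I_(l + l) -> U) :
  \sum_j F j = \sum_i (F (idx i) + F (idx' i)).
Proof.
rewrite big_split_ord big_split /=; congr (_ + _).
rewrite (reindex_inj rev_ord_inj); apply: eq_bigr => i _; congr F.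
by apply: val_inj; have := ltn_ord i => /=; lia.
Qed.

Lemma e_vecE i : e_vec ap am i = gl (idx i) (idx' i).
Proof. by rewrite /gl_vector letter_mode. Qed.

Lemma f_vecE i : f_vec ap am i = gl (idx' i) (idx i).
Proof. by rewrite (gl_vectorE weyl_letter) letter_mode. Qed.

Lemma h_vecE i : h_vec ap am i = gl (idx' i) (idx' i) - gl (idx i) (idx i).
Proof. by rewrite addrC /gl_vector !letter_mode. Qed.

Definition in_pair i j : bool := (j == idx i) || (j == idx' i).

(** The vector H^(i), presented as a current so that its commutators with the
    letters come from [charge_commutator]. *)
Definition heis_vec i : M := charge_vector letter (fun j => (in_pair i j)%:R).

Lemma charge_vector_pairs (s : 'I_(l + l) -> K) i :
    (forall j, ~~ in_pair i j -> s j = 0) ->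
  charge_vector letter s =
  s (idx i) *: gl (idx i) (idx i) + s (idx' i) *: gl (idx' i) (idx' i).
Proof.
move=> s0; rewrite /charge_vector sum_pairs (bigD1 i) //= big1 ?addr0 // => i'.
move=> /negPf neq_i; rewrite !s0 ?scale0r ?addr0 // /in_pair.
  by rewrite [idx' _ == idx i]eq_sym idx_idx' idx'_eq neq_i.
by rewrite idx_idx' idx_eq neq_i.
Qed.

Lemma heis_vecE i : heis_vec i = gl (idx i) (idx i) + gl (idx' i) (idx' i).
Proof.
rewrite /heis_vec (@charge_vector_pairs _ i) => [|j /negPf ->//].
by rewrite /in_pair !eqxx orbT !scale1r.
Qed.

Lemma in_pair_idx i i' : in_pair i (idx i') = (i' == i).
Proof. by rewrite /in_pair idx_eq idx_idx' orbF. Qed.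

Lemma in_pair_idx' i i' : in_pair i (idx' i') = (i' == i).
Proof. by rewrite /in_pair idx'_eq [idx' _ == _]eq_sym idx_idx'. Qed.

Lemma h_vec_charge i : h_vec ap am i =
  charge_vector letter (fun j => (j == idx' i)%:R - (j == idx i)%:R).
Proof.
rewrite (@charge_vector_pairs _ i) => [|j]; last first.
  by rewrite negb_or => /andP[/negPf -> /negPf ->]; rewrite subrr.
rewrite !eqxx idx_idx' [idx' _ == _]eq_sym idx_idx' sub0r subr0.
by rewrite scaleN1r scale1r h_vecE addrC.
Qed.

Lemma heis_family_heis_vec : heisenberg_family heis_vec.
Proof.
move=> i i' n; rewrite (charge_products weyl_letter); case: (n =P 1) => //= _.
rewrite sum_pairs (bigD1 i) //= big1 ?addr0 => [|k /negPf neq_k]; last first.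
  by rewrite in_pair_idx in_pair_idx' neq_k !mul0r addr0.
rewrite !in_pair_idx !in_pair_idx' eqxx !mul1r.
by case: eqP; rewrite ?addr0 ?oppr0 ?scale0r.
Qed.

Lemma heis_vec_regular i i' (n : nat) :
  [/\ vprod n (heis_vec i) (e_vec ap am i') = 0,
      vprod n (heis_vec i) (f_vec ap am i') = 0
    & vprod n (heis_vec i) (h_vec ap am i') = 0].
Proof.
rewrite e_vecE f_vecE h_vec_charge !(charge_gl_products weyl_letter).
rewrite (charge_products weyl_letter) in_pair_idx in_pair_idx'.
rewrite [idx' _ == _]eq_sym idx_idx' subrr mulr0 !scale0r !if_same.
split=> //; rewrite (_ : \sum_j _ = 0) ?oppr0 ?scale0r ?if_same //.
rewrite sum_pairs big1 // => k _; rewrite in_pair_idx in_pair_idx'.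
by rewrite !idx_eq !idx'_eq idx_idx' [idx' _ == _]eq_sym idx_idx' -mulrDr subr0
  sub0r addNr mulr0.
Qed.

Definition sl2_commutant v : Prop :=
  forall u (n : int), affine_A1_power ap am u -> 0 <= n -> vprod n u v = 0.

Lemma affine_A1_power_subalgebra : vertex_subalgebra (affine_A1_power ap am).
Proof.
split.
- split=> [S [[S0 _] _ _] // |c u v Au Av S subS GS];
  have [[_ Slin] _ _] := subS.
  by apply: Slin; [exact: Au|exact: Av].
- by move=> S [].
- move=> n u v Au Av S subS GS; have [_ _ Sprod] := subS.
  by apply: Sprod; [exact: Au|exact: Av].
Qed.

Lemma sl2_commutant_generators v :
    (forall i (n : nat), [/\ vprod n (e_vec ap am i) v = 0,
       vprod n (f_vec ap am i) v = 0 & vprod n (h_vec ap am i) v = 0]) ->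
  sl2_commutant v.
Proof.
move=> gen0 u n Au; move: n;
  apply: (Au (fun u => forall n, 0 <= n -> vprod n u v = 0)).
  exact: centralizer_subalgebra.
by move=> _ [i [] ->] [n|//] _; case: (gen0 i n).
Qed.

Lemma sl2_commutant_subspace : subspace sl2_commutant.
Proof.
split=> [u n _ _|c u v Cu Cv w n Aw n_ge0]; first exact: vprod0r.
by rewrite !vprodE Cu // Cv // scaler0 addr0.
Qed.

Lemma affine_A1_power_gen i : [/\ affine_A1_power ap am (e_vec ap am i),
  affine_A1_power ap am (f_vec ap am i) &
    affine_A1_power ap am (h_vec ap am i)].
Proof.
split=> S _; apply; exists i;
  by [apply: Or31 | apply: Or32 | apply: Or33].
Qed.

Lemma sl2_commutant_heis_mode i n v :
  sl2_commutant v -> sl2_commutant (vprod n (heis_vec i) v).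
Proof.
move=> Cv; apply: sl2_commutant_generators => i' m.
have [Ae Af Ah] := affine_A1_power_gen i'.
by split; rewrite -commute_modes ?Cv ?vprod0r // => k;
  case: (heis_vec_regular i i' k).
Qed.

Lemma word_span_sl2_commutant v : word_span heis_vec v -> sl2_commutant v.
Proof.
apply: word_span_ind => [||i n u]; first exact: sl2_commutant_subspace.
  by move=> u n _; exact: vprod_creation.
exact: sl2_commutant_heis_mode.
Qed.

(** On words this is four times the conformal weight plus the squares of the
    charges; both contributions are nonnegative, and the first vanishes on the
    vacuum only. *)
Definition weyl_energy v : M :=
  2 *: vprod 1 (weyl_stress letter) v
  + \sum_i vprod 0 (heis_vec i) (vprod 0 (heis_vec i) v).

Lemma weyl_energy_linear : linear weyl_energy.
Proof.
move=> c u v; rewrite /weyl_energy !vprodE scalerDr !scalerA [2 * c]mulrC.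
rewrite scalerDr scaler_sumr addrACA -scalerA -big_split; congr (_ + _).
by apply: eq_bigr => i _; rewrite !vprodE.
Qed.

HB.instance Definition _ :=
  GRing.isLinear.Build K M M *:%R weyl_energy weyl_energy_linear.

(** The sl_2 currents, hence their Casimir vectors, act by zero in nonnegative
    modes, so that only the Heisenberg part of the conformal vector remains. *)
Lemma weyl_energy_commutant v :
  sl2_commutant v -> weyl_energy v = heisenberg_energy heis_vec v.
Proof.
move=> Cv; rewrite /weyl_energy /heisenberg_energy sumrB addrC; congr (_ + _).
rewrite /weyl_stress sum_pairs vprod_suml scaler_sumr -sumrN.
apply: eq_bigr => i _; rewrite -vprodZl -vprodNl.
set X := 2 *: _; set Y := heisenberg_square _ _.
apply/eqP; rewrite -subr_eq0 -vprodNl -vprodDl opprK; apply/eqP.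
have [Ae Af Ah] := affine_A1_power_gen i.
have [subA _ prodA] := affine_A1_power_subalgebra.
suff -> : X + Y = 2 *: (vprod (-1) (e_vec ap am i) (f_vec ap am i)
    + vprod (-1) (f_vec ap am i) (e_vec ap am i))
    + vprod (-1) (h_vec ap am i) (h_vec ap am i).
  apply: Cv => //; apply: (subspaceD subA); last exact: prodA.
  by apply: (subspaceZ subA); apply: (subspaceD subA); exact: prodA.
have neq_i : idx i != idx' i by rewrite idx_idx'.
rewrite /X -(gl2_casimir weyl_letter neq_i) /Y /heisenberg_square.
rewrite e_vecE f_vecE h_vecE heis_vecE !vprodE.
move: (vprod _ _ _ + vprod _ _ (gl (idx i) (idx' i))) => EF.
move: (vprod _ (gl (idx i) (idx i)) _) (vprod _ _ (gl (idx i) (idx i))) => R S.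
rewrite -[EF - R - S]addrA -opprD scalerBr -[LHS]addrA; congr (_ + _).
rewrite scaler_nat mulr2n [_ + _ + (S + _)](AC (2*2) ((2*3)*(1*4))) /=.
rewrite opprD -[LHS]addrA addKr opprD opprB.
by rewrite [LHS](AC (2*2) ((4*2)*(3*1))).
Qed.

Definition heis_charge i (s : seq ('I_(l + l) * bool * nat)) : int :=
  \sum_(ck <- s | in_pair i ck.1.1) (if ck.1.2 then -1 else 1).

Lemma heis_vec_word i s : vprod 0 (heis_vec i) (creation_word letter s) =
  (heis_charge i s)%:~R *: creation_word letter s.
Proof.
elim: s => [|[[j b] k] s IHs].
  by rewrite /heis_charge big_nil scale0r vprod_creation.
rewrite /= (charge_commutator weyl_letter) addr0 -/(heis_vec i) IHs vprodZr.
rewrite -scalerDl /heis_charge big_cons /charge /=; congr (_ *: _).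
by case: (in_pair i j); case: b;
  rewrite /= ?intrD ?rmorphN1 ?oppr0 ?addr0 // addrC.
Qed.

Definition word_energy (s : seq ('I_(l + l) * bool * nat)) : nat :=
  (\sum_(ck <- s) 2 * (2 * ck.2).+1 + \sum_i `|heis_charge i s| ^ 2)%N.

Lemma weyl_energy_word s :
  weyl_energy (creation_word letter s) =
  (word_energy s)%:R *: creation_word letter s.
Proof.
have stress : vprod 1 (weyl_stress letter) (creation_word letter s) =
    (\sum_(ck <- s) (2 * ck.2).+1)%:R *: creation_word letter s.
  elim: s => [|[c k] s IHs] /=; first by rewrite big_nil scale0r vprod_creation.
  rewrite (weyl_stress_commutator weyl_letter) IHs vprodZr -scalerBl big_cons.
  congr (_ *: _); rewrite natrD addrC; congr (_ + _).
  by rewrite /= rmorphN /= -!pmulrn -[in RHS]natr1 natrM -natr1; ring.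
rewrite /weyl_energy stress scalerA.
rewrite (eq_bigr
  (fun i => (`|heis_charge i s| ^ 2)%:R *: creation_word letter s)).
  rewrite -scaler_suml -scalerDl; congr (_ *: _).
  by rewrite natrD -natr_sum -natrM big_distrr.
move=> i _; rewrite heis_vec_word vprodZr heis_vec_word scalerA; congr (_ *: _).
rewrite -rmorphM [RHS]pmulrn /= -mulnn PoszM abszE -normrM.
by rewrite -expr2 ger0_norm ?sqr_ge0.
Qed.

(** For the inclusion from left to right, the commutant is stable under the
    Heisenberg modes and [weyl_energy] provides the spectrum. *)
Lemma sl2_commutantE v : sl2_commutant v <-> word_span heis_vec v.
Proof.
split; last exact: word_span_sl2_commutant.
apply: (heisenberg_energy_induction heis_family_heis_vec (T := weyl_energy)).
- exact: sl2_commutant_subspace.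
- exact: word_span_subspace.
- exact: sl2_commutant_heis_mode.
- by move=> i n u; exact: word_span_mode.
- move=> u _; apply: (creation_energy weyl_energy_word _ (letters_span u)).
  by case=> // ck s; rewrite /word_energy big_cons; case: ck.2 => *; lia.
- exact: weyl_energy_commutant.
- move=> c _; apply: (subspaceZ (word_span_subspace _)).
  by have [] := word_span_subalgebra heis_vec.
Qed.

End InWeyl.

(** * The two commuting Weyl subalgebras *)

Section TensorSquare.
Variables (K : numClosedFieldType) (l : nat) (M : vertexAlgebra K).
Variables ap am : 'I_(l + l) -> int -> {linear M -> M}.
Hypothesis hM : weyl_vertex_algebra ap am.
Implicit Types (i : 'I_l) (c d : 'I_l * bool * bool) (p s : bool) (u v w : M).

(** ((i, p), s) stands for b_i^s if p is false, and for b_(2l+1-i)^s if p is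
    true. *)
Definition b_letter c : M :=
  match c with
  | (i, false, true) => bp ap am i
  | (i, false, false) => bm ap am i
  | (i, true, true) => bp' ap am i
  | (i, true, false) => bm' ap am i
  end.

Let b_scale p s : K := if p then (if s then 'i else - 'i) else 1.

Lemma b_letterE i p s : b_letter (i, p, s) = (b_scale p s / sqrtC 2) *:
  (letter ap am (idx i, s) + (-1) ^+ (p == s) *: letter ap am (idx' i, ~~ s)).
Proof.
by case: p s => -[];
  rewrite /= /letter /= ?expr0 ?expr1 ?scaleN1r ?scale1r ?mul1r.
Qed.

Let sqrt2V : (sqrtC 2)^-1 * (sqrtC 2)^-1 = 2^-1 :> K.
Proof. by rewrite -invfM -expr2 sqrtCK. Qed.

Lemma weyl_b_letter : weyl_family b_letter.
Proof.
move=> [[i p] s] [[i' p'] s'] n; rewrite !b_letterE !vprodE.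
rewrite !(weyl_letter hM); case: eqP => _; last by rewrite !(scaler0, addr0).
rewrite /weyl_form /= idx_eq idx'_eq idx_idx' [idx' _ == _]eq_sym idx_idx'.
rewrite !scale0r !scaler0 addr0 add0r xpair_eqE.
case: eqP => _ /=; last by rewrite !(scale0r, scaler0, addr0).
rewrite !scalerA -!scalerDl !scalerA; congr (_ *: _).
transitivity (b_scale p s * b_scale p' s' / 2 * ((s%:R - s'%:R) +
    (-1) ^+ (p == s) * (-1) ^+ (p' == s') * ((~~ s)%:R - (~~ s')%:R))).
  by rewrite -sqrt2V; ring.
have ii : 'i * 'i = -1 :> K by rewrite -expr2 sqrCi.
by case: p p' s s' => -[] [] [];
  rewrite /b_scale /= ?expr0 ?expr1 ?mulrN ?mulNr ?ii; field.
Qed.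

Definition b_degree c : bool * bool := (~~ c.1.2, c.1.2).

Notation bispan := (gspan b_degree b_letter).

(** The two parities are those of the charges under the currents built from the
    letters of one kind only. *)
Lemma bispan_disjoint g h v : g != h -> bispan g v -> bispan h v -> v = 0.
Proof.
pose q p c : int := if c.1.2 == p then (if c.2 then -1 else 1) else 0.
pose T p : {linear M -> M} :=
  vprod 0 (charge_vector b_letter (fun j => (j.2 == p)%:R)).
have T_vac p : T p vacuum = 0 by exact: vprod_creation.
have T_mode p c n v' : T p (vprod n (b_letter c) v') =
    vprod n (b_letter c) (T p v') + (q p c)%:~R *: vprod n (b_letter c) v'.
  rewrite /T /= (charge_commutator weyl_b_letter) addr0 /charge /q.
  by case: eqP; case: c.2; rewrite ?oppr0.
have q1 c (g' : bool * bool) : (b_degree c + g').1 = odd `|q false c| (+) g'.1.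
  by case: c g' => [[i []] []] [].
have q2 c (g' : bool * bool) : (b_degree c + g').2 = odd `|q true c| (+) g'.2.
  by case: c g' => [[i []] []] [].
case: g h => [g1 g2] [h1 h2]; rewrite xpair_eqE negb_and => /orP[] neq_gh.
- exact: (@gspan_disjoint _ _ (T false) _ _ _ _ (q false) fst
            erefl q1 (T_vac false) (T_mode false) (g1, g2) (h1, h2)).
- exact: (@gspan_disjoint _ _ (T true) _ _ _ _ (q true) snd
            erefl q2 (T_vac true) (T_mode true) (g1, g2) (h1, h2)).
Qed.

(** The generators of the two tensor factors. *)
Definition half_letter p (k : 'I_l * bool) : M := b_letter (k.1, p, k.2).

Lemma half_bispan p b v : parity_span (half_letter p) b v ->
  bispan (if p then (false, b) else (b, false)) v.
Proof.
elim=> {b v} [b||b c u v _ IHu _ IHv|b [i s] n u _ IHu].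
- exact: gspan_zero.
- by case: p; exact: gspan_vacuum.
- exact: gspan_lin.
have := gspan_mode (i, p, s) n IHu.
by case: p {IHu}.
Qed.

Lemma half_disjoint p v :
  parity_span (half_letter p) false v ->
    parity_span (half_letter p) true v -> v = 0.
Proof. by move=> /half_bispan v0 /half_bispan; apply: bispan_disjoint v0;
  case: p. Qed.

Lemma bgenE (x : M) : bgen ap am x <-> exists k, x = half_letter false k.
Proof.
split=> [[i [] ->]|[[i []] ->]].
- by exists (i, true).
- by exists (i, false).
- by exists i; left.
- by exists i; right.
Qed.

Lemma bgen'E (x : M) : bgen' ap am x <-> exists k, x = half_letter true k.
Proof.
split=> [[i [] ->]|[[i []] ->]].
- by exists (i, true).
- by exists (i, false).
- by exists i; left.
- by exists i; right.
Qed.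

Let generators_fixed (G : M -> Prop) p v :
    (forall x, G x <-> exists k, x = half_letter p k) ->
  sign_fixed (generated_subalgebra G) G v <->
    parity_span (half_letter p) false v.
Proof.
move=> GE; apply: sign_fixed_even => [|k|g /GE [k ->]|u|u].
- by rewrite pnatr_eq0.
- by apply/GE; exists k.
- exact: gspan_gen.
- exact: generated_word_span.
- exact: half_disjoint.
Qed.

Lemma weyl_evenE v : weyl_even ap am v <->
  parity_span (half_letter false) false v.
Proof. exact: generators_fixed bgenE. Qed.

Lemma weyl_even'E v : weyl_even' ap am v <->
  parity_span (half_letter true) false v.
Proof. exact: generators_fixed bgen'E. Qed.

Lemma half_regular_letter p b i s w (n : nat) :
  parity_span (half_letter (~~ p)) b w -> vprod n (b_letter (i, p, s)) w = 0.
Proof.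
elim=> {b w} [b||b c u v _ IHu _ IHv|b [i' s'] m u _ IHu].
- exact: vprod0r.
- exact: vprod_creation.
- by rewrite !vprodE IHu IHv scaler0 addr0.
rewrite (weyl_swap_form weyl_b_letter) ?IHu ?vprod0r //.
by rewrite /weyl_form /= xpair_eqE; case: p {IHu}; rewrite andbF.
Qed.

Lemma half_regular p b b' u w (n : nat) :
  parity_span (half_letter p) b u -> parity_span (half_letter (~~ p)) b' w ->
  vprod n u w = 0.
Proof.
move=> bu bw; move: n; suff reg (n : int) : 0 <= n -> vprod n u w = 0.
  by move=> n; exact: reg.
move: n; apply: (gspan_sub_subalgebra (centralizer_subalgebra w) _ bu) =>
  -[i s].
by case=> // n _; exact: half_regular_letter bw.
Qed.

(** Sorting a word: the letters of the second kind commute with the first tensor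
    factor, those of the first kind are regular against the second. *)
Lemma bispan_tensor g v : bispan g v ->
  tensor_subspace (parity_span (half_letter false) g.1)
                  (parity_span (half_letter true) g.2) v.
Proof.
elim=> {g v} [g||g c u v _ IHu _ IHv|g [[i p] s] n v _ IHv].
- exact: subspace0 (lin_span_subspace _).
- apply: lin_span_gen; exists vacuum, vacuum; split; try exact: gspan_vacuum.
  by rewrite vprod_creationN1.
- exact: (lin_span_subspace _).2.
apply: (IHv (fun v => tensor_subspace _ _ (vprod n (b_letter (i, p, s)) v))).
  exact: (subspace_preimage (vprod n (b_letter (i, p, s)))
    (lin_span_subspace _)).
move=> _ [u [w [bu bw ->]]]; apply: lin_span_gen; case: p.
- exists u, (vprod n (b_letter (i, true, s)) w); split.
  + by rewrite /= add0r.
  + exact: (parity_span_mode n (i, s) bw).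
  by by apply: commute_modes => k; exact: (@half_regular_letter true g.1).
- exists (vprod n (b_letter (i, false, s)) u), w; split.
  + exact: (parity_span_mode n (i, s) bu).
  + by rewrite /= add0r.
  rewrite tensor_mode_left // => k.
    exact: (@half_regular false g.1 g.2).
  exact: (@half_regular_letter false g.2).
Qed.

Lemma affine_C_squareE v : affine_C_square ap am v <-> bispan 0 v.
Proof.
split.
  apply; first exact: gspan_subspace.
  move=> _ [u [w [/weyl_evenE/half_bispan bu /weyl_even'E/half_bispan bw ->]]].
  exact: (gspan_vprod (-1) bu bw).
move=> /bispan_tensor; apply; first exact: lin_span_subspace.
move=> _ [u [w [bu bw ->]]]; apply: lin_span_gen; exists u, w; split=> //.
  exact/weyl_evenE.
exact/weyl_even'E.
Qed.

Lemma heis_vec_b i : heis_vec ap am i =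
  'i *: (gl_vector b_letter (i, false) (i, true)
         - gl_vector b_letter (i, true) (i, false)).
Proof.
rewrite heis_vecE (gl_vectorE (weyl_letter hM) (idx' i)).
rewrite /gl_vector !b_letterE !vprodE /= expr0 expr1 !scale1r !scaleN1r.
move: (vprod _ _ _) (vprod _ _ _) (vprod _ _ _) (vprod _ _ _) => C B D A.
rewrite -scalerDr -scalerBr ['i *: (_ - _)]scalerBr !scalerA.
have ii : 'i * 'i = -1 :> K by rewrite -expr2 sqrCi.
have -> : 'i * (1 / sqrtC 2 * (- 'i / sqrtC 2)) = 2^-1 :> K.
  transitivity (- ('i * 'i) * ((sqrtC 2)^-1 * (sqrtC 2)^-1) : K); first by ring.
  by rewrite ii opprK mul1r sqrt2V.
have -> : 'i * ('i / sqrtC 2 * (1 / sqrtC 2)) = - 2^-1 :> K.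
  transitivity ('i * 'i * ((sqrtC 2)^-1 * (sqrtC 2)^-1) : K); first by ring.
  by rewrite ii mulN1r sqrt2V.
rewrite scaleNr opprK -scalerDr.
have -> : A + B + (C + D) + (A - B - (C - D)) = (A + D) + (A + D).
  rewrite addrACA [A + B + _]addrACA subrr addr0 opprB [C + D]addrC.
  by rewrite [D + C + _]addrACA subrr addr0 addrACA.
by rewrite -mulr2n -scaler_nat scalerA mulVf ?scale1r ?pnatr_eq0.
Qed.

Lemma heis_vec_bispan i : bispan (true, true) (heis_vec ap am i).
Proof.
have sub11 := gspan_subspace b_degree b_letter (true, true).
rewrite heis_vec_b; apply: (subspaceZ sub11); apply: (subspaceB sub11).
  exact: (gspan_mode (i, false, true) (-1)
    (gspan_gen b_degree b_letter (i, true, false))).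
exact: (gspan_mode (i, true, true) (-1)
  (gspan_gen b_degree b_letter (i, false, false))).
Qed.

Lemma heis_span_bispan b v : parity_span (heis_vec ap am) b v ->
  bispan (b, b) v.
Proof.
elim=> {b v} [b||b c u v _ IHu _ IHv|b i n u _ IHu].
- exact: gspan_zero.
- exact: gspan_vacuum.
- exact: gspan_lin.
exact: (gspan_vprod n (heis_vec_bispan i) IHu).
Qed.

Lemma heis_span_disjoint v : parity_span (heis_vec ap am) false v ->
  parity_span (heis_vec ap am) true v -> v = 0.
Proof. by move=> /heis_span_bispan v0 /heis_span_bispan;
  exact: bispan_disjoint v0. Qed.

(** Each H^(i) is odd in both kinds of letters, so that the even words in the
    H^(i) are exactly those parts of the Heisenberg subalgebra which survive the
    two sign automorphisms. *)
Lemma commutantE v :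
  commutant (affine_A1_power ap am) (affine_C_square ap am) v <->
  parity_span (heis_vec ap am) false v.
Proof.
split=> [[/affine_C_squareE v00 Cv]|v0].
  have [v0 v0P v1P] := (sl2_commutantE hM v).1 Cv.
  suff /eqP : v - v0 = 0 by rewrite subr_eq0 => /eqP ->.
  apply: (bispan_disjoint (g := 0) _ _ (heis_span_bispan v1P)) => //.
  exact: (subspaceB (gspan_subspace _ _ _) v00 (heis_span_bispan v0P)).
split; first exact/affine_C_squareE/heis_span_bispan.
exact: ((sl2_commutantE hM v).2 (parity_word_span v0)).
Qed.

End TensorSquare.

(** * Comparison of Heisenberg vertex algebras *)

Section Comparison.
Variables (K : numFieldType) (V W : vertexAlgebra K) (l : nat).
Variables (x : 'I_l -> V) (x' : 'I_l -> W).
Hypotheses (heis_x : heisenberg_family x) (heis_x' : heisenberg_family x').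
Hypotheses (V_neq0 : (vacuum : V) != 0) (W_neq0 : (vacuum : W) != 0).
Implicit Types (b : bool) (v : V) (w : W).

(** The subalgebra generated by these vectors will be the graph of the
    isomorphism. *)
Definition diagonal_vec i : vertex_product V W := (x i, x' i).

Let z := diagonal_vec.

Let heis_z : heisenberg_family z.
Proof.
move=> i j n; rewrite [LHS]/(pair_prod _ _ _) /pair_prod /= heis_x heis_x'.
by case: ifP.
Qed.

(** The vectors (0, w) of the graph form a stable subspace of a Fock space, and
   this subspace misses its vacuum vector since V is nonzero. *)
Let graph_word_functional w : word_span z (0, w) -> w = 0.
Proof.
pose S (p : vertex_product V W) := word_span z p /\ p.1 = 0.
have [[W0 Wlin] _ _] := word_span_subalgebra z.
suff S0 p : S p -> p = 0.
  by move=> wz; exact: (congr1 snd (S0 (0, w) (conj wz erefl))).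
apply: (fock_irreducible heis_z).
- split=> [|c u v [wu u0] [wv v0]]; first by split; [exact: W0|].
  split; first exact: Wlin.
  by rewrite /= u0 v0 scaler0 addr0.
- by move=> v [].
- move=> i n v [wv v0]; split; first exact: word_span_mode.
  by rewrite /= v0 vprod0r.
- by move=> [_ /eqP]; rewrite (negPf V_neq0).
Qed.

Let graph_word_injective v : word_span z (v, 0) -> v = 0.
Proof.
pose S (p : vertex_product V W) := word_span z p /\ p.2 = 0.
have [[W0 Wlin] _ _] := word_span_subalgebra z.
suff S0 p : S p -> p = 0.
  by move=> wz; exact: (congr1 fst (S0 (v, 0) (conj wz erefl))).
apply: (fock_irreducible heis_z).
- split=> [|c u u' [wu u0] [wu' u'0]]; first by split; [exact: W0|].
  split; first exact: Wlin.
  by rewrite /= u0 u'0 scaler0 addr0.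
- by move=> u [].
- move=> i n u [wu u0]; split; first exact: word_span_mode.
  by rewrite /= u0 vprod0r.
- by move=> [_ /eqP]; rewrite (negPf W_neq0).
Qed.

Let graph_functional v w w' :
  word_span z (v, w) -> word_span z (v, w') -> w = w'.
Proof.
move=> vw vw'; apply/eqP; rewrite -subr_eq0; apply/eqP/graph_word_functional.
have eq_diff : (v - v, w - w') = (0, w - w') by rewrite subrr.
by rewrite -eq_diff; exact: (subspaceB (word_span_subspace z) vw vw').
Qed.

Let graph_injective v v' w :
  word_span z (v, w) -> word_span z (v', w) -> v = v'.
Proof.
move=> vw v'w; apply/eqP; rewrite -subr_eq0; apply/eqP/graph_word_injective.
have eq_diff : (v - v', w - w) = (v - v', 0) by rewrite subrr.
by rewrite -eq_diff; exact: (subspaceB (word_span_subspace z) vw v'w).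
Qed.

Let graph_proj b (p : vertex_product V W) : parity_span z b p ->
  parity_span x b p.1 /\ parity_span x' b p.2.
Proof.
elim=> {b p} [b||b c u v _ [u1 u2] _ [v1 v2]|b i n u _ [u1 u2]].
- by split; exact: gspan_zero.
- by split; exact: gspan_vacuum.
- by split; exact: gspan_lin.
- by split; exact: gspan_mode.
Qed.

Let graph_total b v : parity_span x b v -> exists w, parity_span z b (v, w).
Proof.
elim=> {b v} [b||b c u v _ [w uw] _ [w' vw']|b i n u _ [w uw]].
- by exists 0; exact: gspan_zero.
- by exists vacuum; exact: gspan_vacuum.
- by exists (c *: w + w'); exact: (gspan_lin c uw vw').
- by exists (vprod n (x' i) w); exact: (gspan_mode i n uw).
Qed.

Let graph_onto b w : parity_span x' b w -> exists v, parity_span z b (v, w).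
Proof.
elim=> {b w} [b||b c u v _ [w uw] _ [w' vw']|b i n u _ [w uw]].
- by exists 0; exact: gspan_zero.
- by exists vacuum; exact: gspan_vacuum.
- by exists (c *: w + w'); exact: (gspan_lin c uw vw').
- by exists (vprod n (x i) w); exact: (gspan_mode i n uw).
Qed.

(** The graph respects parity, so a vector of both parities in W would come from
    one in V. *)
Lemma parity_disjoint_transfer :
    (forall v, parity_span x false v -> parity_span x true v -> v = 0) ->
  forall w, parity_span x' false w -> parity_span x' true w -> w = 0.
Proof.
move=> disj w /graph_onto [v0 v0w] /graph_onto [v1 v1w].
have [v0P _] := graph_proj v0w; have [v1P _] := graph_proj v1w.
have eqv := graph_injective (parity_word_span v0w) (parity_word_span v1w).
apply: graph_word_functional; rewrite -(disj v0 v0P) ?eqv //.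
exact: parity_word_span v1w.
Qed.

Lemma heisenberg_even_isomorphic :
  isomorphic (parity_span x false) (parity_span x' false).
Proof.
split; [exact: gspan0_subalgebra | exact: gspan0_subalgebra |].
have /choice [f fP] v : exists w, parity_span x false v ->
  parity_span z false (v, w).
  have [/graph_total [w vw]|nv] := pselect (parity_span x false v).
    by exists w.
  by exists 0.
have [[_ lin0] vac0 prod0] := gspan0_subalgebra (fun=> true : bool) z.
have [[_ xlin0] xvac0 xprod0] := gspan0_subalgebra (fun=> true : bool) x.
have graph_f v w : parity_span z false (v, w) -> f v = w.
  move=> vw; have [vP _] := graph_proj vw.
  exact: graph_functional (parity_word_span (fP v vP)) (parity_word_span vw).
exists f; split; split.
- move=> c u v u0 v0; apply: graph_f.
  exact: (lin0 c _ _ (fP u u0) (fP v v0)).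
- exact: graph_f vac0.
- move=> n u v u0 v0; apply: graph_f.
  exact: (prod0 n _ _ (fP u u0) (fP v v0)).
- by move=> u /fP /graph_proj [].
- move=> u v /fP /parity_word_span uz /fP /parity_word_span vz eqf.
  by apply: graph_injective uz _; rewrite eqf.
- by move=> w /graph_onto [v vw]; exists v;
  [have [] := graph_proj vw|exact: graph_f].
Qed.

End Comparison.

(** * The free boson vertex algebra *)

Section FreeBoson.
Variables (K : numClosedFieldType) (l : nat) (W : vertexAlgebra K).
Variable hm : 'rV[K]_l -> int -> {linear W -> W}.
Hypothesis hW : heisenberg_vertex_algebra (@hform K l) hm.
Implicit Types (i j : 'I_l) (u : 'rV[K]_l) (w : W).

Definition boson_vec i : W := hm (delta_mx 0 i) (-1) vacuum.

Lemma boson_vec_mode i n w : vprod n (boson_vec i) w = hm (delta_mx 0 i) n w.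
Proof. exact: heis_field hW _ _ _. Qed.

Lemma boson_mode_sum u n w :
  hm u n w = \sum_i u 0 i *: vprod n (boson_vec i) w.
Proof.
pose f u := hm u n w.
have f_lin : linear f := heis_linear hW n w.
have f0 : f 0 = 0 by have := f_lin (-1) 0 0;
  rewrite scaleN1r oppr0 addr0 scaleN1r addNr.
rewrite -/(f u) {1}[u]row_sum_delta.
elim: (index_enum _) => [|i s IHs]; first by rewrite !big_nil.
by rewrite !big_cons f_lin IHs boson_vec_mode.
Qed.

Lemma heis_family_boson_vec : heisenberg_family boson_vec.
Proof.
move=> i j n; rewrite boson_vec_mode.
have := heis_comm hW (delta_mx 0 i) (delta_mx 0 j) n (-1) vacuum.
rewrite [hm _ n vacuum](heis_vacuum hW) // linear0 subr0 => ->.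
rewrite subr_eq0 eqz_nat; case: eqP => //= ->; rewrite mul1r /hform.
rewrite (bigD1 i) //= big1 ?addr0 => [|k /negPf neq_k]; rewrite !mxE.
  by rewrite !eqxx mul1r eq_sym; case: eqP; rewrite ?mulr1 // mulr0 scale0r.
by rewrite neq_k mul0r.
Qed.

Lemma boson_word_span w : word_span boson_vec w.
Proof.
have X_basis := vbasisP {: 'rV[K]_l}.
have subW := word_span_subspace boson_vec.
apply: (heis_span hW X_basis w) => // _ [s ->].
elim: s => [|[j k] s IHs] /=; first exact: parity_word_span (gspan_vacuum _ _).
rewrite boson_mode_sum; apply: subspace_sum => // i _; apply: subspaceZ => //.
exact: word_span_mode.
Qed.

Lemma boson_vacuum_neq0 : (vacuum : W) != 0.
Proof.
apply/eqP => vac0; have X_basis := vbasisP {: 'rV[K]_l}.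
have := heis_free hW X_basis (ss := [:: [::]]) (c := fun=> 1) isT.
rewrite big_seq1 scale1r /= => /(_ vac0 [::]); rewrite mem_head =>
  /(_ isT) /eqP.
by rewrite oner_eq0.
Qed.

Lemma heisenberg_plusE w :
    (forall w, parity_span boson_vec false w -> parity_span boson_vec true w ->
      w = 0) ->
  heisenberg_plus hm w <-> parity_span boson_vec false w.
Proof.
move=> disj; apply: sign_fixed_even => [|i|_ [u ->]|v|] //.
- by rewrite pnatr_eq0.
- by exists (delta_mx 0 i).
- rewrite boson_mode_sum.
  have sub1 := gspan_subspace (fun=> true : bool) boson_vec true.
  apply: (subspace_sum sub1) => i _; apply: (subspaceZ sub1).
  by rewrite vprod_creationN1; exact: gspan_gen.
- by split=> // _; exact: boson_word_span.
Qed.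

End FreeBoson.

Theorem theorem2 (R : realType) (l : nat) (hl : (1 <= l)%N)
    (M : vertexAlgebra R[i])
    (ap am : 'I_(l + l) -> int -> {linear M -> M})
    (hM : weyl_vertex_algebra ap am)
    (W : vertexAlgebra R[i])
    (hm : 'rV[R[i]]_l -> int -> {linear W -> W})
    (hW : heisenberg_vertex_algebra (@hform R[i] l) hm) :
  isomorphic (commutant (affine_A1_power ap am) (affine_C_square ap am))
             (heisenberg_plus hm).
Proof.
have heisM := @heis_family_heis_vec _ _ _ _ _ hM.
have heisW := heis_family_boson_vec hW.
have M_neq0 := weyl_vacuum_neq0 hM; have W_neq0 := boson_vacuum_neq0 hW.
have disj := parity_disjoint_transfer heisM heisW M_neq0 W_neq0
  (heis_span_disjoint hM).
have -> : commutant (affine_A1_power ap am) (affine_C_square ap am) =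
    parity_span (heis_vec ap am) false.
  by apply/funext => v; apply/propext; exact: commutantE.
have -> : heisenberg_plus hm = parity_span (boson_vec hm) false.
  by apply/funext => w; apply/propext; exact: heisenberg_plusE.
exact: heisenberg_even_isomorphic.
Qed.
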